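(* Let $N\ge 1$, $T>0$, let the costs $C,\tilde C$ satisfy all the assumptions listed in the context, and let an initial distribution $(\rho_0^0,\dots,\rho^0_{2^N-1})$ of masses on the nodes be given. Assume moreover that the optimal switching functions are single-valued: for every $\rho$, every $p\in\mathcal I\setminus\{\bar p\}$, $p'\in\mathcal I_p$ and $t\in[0,T[$, the set $\varphi_{p,p'}(t)$ of switching instants optimally generated by the switch from $p$ to $p'$ with decision instant $t$ is a singleton. Then there exists a mean-field equilibrium, i.e. there exists $\rho\in L^2([0,T],[0,1])^{2^N}$ such that $\rho\in\psi(\rho)$, where $\psi$ is the multi-valued map defined in the context.
   Context: **Network and controls.** $\mathcal I=\{0,1\}^N$ is the set of nodes, enumerated $p_0,\dots,p_{2^N-1}$; $\bar p=(1,\dots,1)$. For $p\in\mathcal I$, $\mathcal I_p$ is the set of nodes obtained from $p$ by changing exactly one component from $0$ to $1$ (so $\mathcal I_{\bar p}=\emptyset$). An admissible control for $(p,t)\in\mathcal I\times[0,T]$ is a triple $(r,\sigma,\pi)$ with $r$ an integer, $0\le r\le N-\sum_i p^i$, $\sigma=(t_0=t<t_1<\dots<t_r\le T)$, $\pi=(p_{(0)}=p,p_{(1)},\dots,p_{(r)})$, $p_{(i+1)}\in\mathcal I_{p_{(i)}}$, such that: if $1\le r<N-\sum_i p^i$ then $t_r=T$; if $r=0$ then $p=\bar p$ or $t=T$. **Costs.** Let $\mathcal L=L^2([0,T],[0,1])^{2^N}$; an element $\rho=(\rho_0,\dots,\rho_{2^N-1})$ represents the masses on the nodes. The switching cost $C(p,p',t,\tau,\rho)\in[0,+\infty[$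 is defined for $p'\in\mathcal I_p$, $0\le t<\tau\le T$, $\rho\in\mathcal L$. The final cost $\tilde C:\mathcal I\times[0,T]\to\mathbb R$ is bounded and Lipschitz continuous in time. Set $$J(p,t,(r,\sigma,\pi),\rho)=\sum_{i=1}^rC(p_{(i-1)},p_{(i)},t_{i-1},t_i,\rho)+\tilde C(p_{(r)},t_r)$$ if $p\ne\bar p$ and $t<T$, and $J=\tilde C(p,t)$ if $p=\bar p$ or $t=T$. The value function is $V(p,t,\rho)=\inf_{(r,\sigma,\pi)}J(p,t,(r,\sigma,\pi),\rho)$. **Assumptions.** (i) For all sufficiently small $h>0$, for all $p$, $p'\in\mathcal I_p$, $\tau\in]0,T]$, the map $(t,\rho)\mapsto C(p,p',t,\tau,\rho)$ is bounded and Lipschitz on $[0,\tau-h]\times\mathcal L$ (with the $L^2$ norm), with bound and Lipschitz constant depending only on $h$, not on $\tau$. (ii) For fixed $p,p',t,\rho$, $C$ is decreasing in $\tau\in]t,T]$, and $\lim_{\tau\to t^+}C(p,p',t,\tau,\rho)=+\infty$ uniformly in $(p,p',t,\rho)$; moreover $\tau\mapsto C(p,p',t,\tau,\rho)$ is continuous on $]t,T[$. (iii) By convention, $C$ is $0$ when the two nodes coincide and when $t=\tau=T$. (iv) An agent which at time $t$ on node $p$ decides to switch to $p'$ at time $\tau$ stays on $p$, and counts in the mass of $p$, during $[t,\tau[$; it takes its next decision exactly at time $\tau$. (v) For $p'\in\mathcal I_p$ and $t<T$, say that the switch from $p$ to $p'$ with decision instant $t$ optimally generates $\tau\in]t,T]$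 if there is an admissible control with $r\ge1$, $t_0=t$, $t_1=\tau$, $p_{(0)}=p$, $p_{(1)}=p'$ minimizing $J$ among all admissible controls with $r\ge1$, $t_0=t$, $p_{(0)}=p$, $p_{(1)}=p'$. The set of all such $\tau$ is denoted $\varphi_{p,p'}(t)$ (it depends also on $\rho$). It is assumed that, for the same switch from $p$ to $p'$ (and the same $\rho$), if decision instants $t_1<t_2$ optimally generate $\tau_1,\tau_2<T$ respectively, then $\tau_1<\tau_2$. **Optimal switches.** For $p\ne\bar p$, $t<T$, $P_\rho(p,t)$ is the set of pairs $(p',t')$, $p'\in\mathcal I_p$, $t'\in]t,T]$, minimizing $V(p',t',\rho)+C(p,p',t,t',\rho)$. When the functions $\varphi_{p,p'}$ are single-valued, $P_\rho(p,t)$ is finite. **Initial masses.** $\rho_j^0\ge0$ is the mass of agents on node $p_j$ at time $0$, with $\sum_j\rho_j^0\le1$. **The map $\psi$ (when the $\varphi_{p,p'}$ are single-valued).** Let $\rho\in\mathcal L$. An optimal path from $p_j$ is a sequence $\pi=((q_0,s_0),(q_1,s_1),\dots,(q_r,s_r))$ with $(q_0,s_0)=(p_j,0)$ and $(q_{i+1},s_{i+1})\in P_\rho(q_i,s_i)$ for $0\le i<r$, stopping when $q_r=\bar p$ or $s_r=T$. $\Pi_j$ denotes the (finite) set of optimal paths from $p_j$. The evolution of a unit mass following $\pi$ is $E^\pi=(E^\pi_0,\dots,E^\pi_{2^N-1})$, where $E^\pi_k(t)=1$ if $p_k=q_i$ for some $i$ with $s_i\le t<s_{i+1}$ (with $s_{r+1}:=T$),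 and $E^\pi_k(t)=0$ otherwise (for a.e. $t\in[0,T]$). Then $\psi(\rho)$ is the set of all $$\tilde\rho=\sum_{j=0}^{2^N-1}\rho_j^0\sum_{\pi\in\Pi_j}w_\pi E^\pi,\qquad w_\pi\ge0,\quad \sum_{\pi\in\Pi_j}w_\pi=1\ \text{ for every } j.$$ The weight $w_\pi$ is the product, along $\pi$, of the fractions according to which agents split at each decision among the optimal next (node, time) pairs. *)

(* Defs.v *)
From mathcomp Require Import all_boot all_order all_algebra.
From mathcomp Require Import all_classical all_reals all_analysis.

Set Implicit Arguments.
Unset Strict Implicit.
Unset Printing Implicit Defensive.

Import Order.TTheory GRing.Theory Num.Theory.
Import numFieldNormedType.Exports.

Local Open Scope classical_set_scope.
Local Open Scope ring_scope.

(* The node p_j of the text is represented by itself: families of masses are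
   indexed by the finite type of nodes instead of by 0, ..., 2^N - 1. *)
Notation node N := {ffun 'I_N -> bool}.

Definition pbar (N : nat) : node N := [ffun=> true].

Definition weight (N : nat) (p : node N) : nat := (\sum_(i < N) p i)%N.

(* The set I_p. *)
Definition succ_nodes (N : nat) (p : node N) : {set node N} :=
  [set q : node N |
    [exists i : 'I_N, ~~ p i && (q == [ffun k => (k == i) || p k])]].

(* Lebesgue measure concentrated on [0, T]; it is a measure on R for which
   everything outside [0, T] is negligible, so that its L^2 space is
   L^2([0, T]). *)
Definition leb0T (R : realType) (T : R) :
    {measure set (measurableTypeR R) -> \bar R} :=
  mrestr (@lebesgue_measure R) (measurable_itv `[0, T]).

(* L^2([0, T], R)^(2^N); its elements are families of a.e.-equality classes. *)
Definition masses (R : realType) (N : nat) (T : R) : Type :=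
  node N -> LspaceType2 (leb0T T).

(* L^2([0, T], [0, 1])^(2^N). *)
Definition calL (R : realType) (N : nat) (T : R) : set (masses N T) :=
  [set rho : masses N T | forall p, {ae leb0T T, forall t, 0 <= rho p t <= 1}].

Definition L2dist (R : realType) (N : nat) (T : R) (rho rho' : masses N T) : R :=
  Num.sqrt (\sum_(p : node N)
    fine ('N[leb0T T]_2%:E[EFin \o (fun t => rho p t - rho' p t)]) ^+ 2).

(* A triple (r, sigma, pi). *)
Record control (R : realType) (N : nat) := Control {
  nswitch : nat;
  ctimes : nswitch.+1.-tuple R;
  cnodes : nswitch.+1.-tuple (node N) }.

Definition ctime (R : realType) (N : nat) (c : control R N) (i : nat) : R :=
  nth 0 (ctimes c) i.

Definition cnode (R : realType) (N : nat) (c : control R N) (i : nat) : node N :=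
  nth (pbar N) (cnodes c) i.

Definition admissible (R : realType) (N : nat) (T : R) (p : node N) (t : R)
    (c : control R N) : Prop :=
  let r := nswitch c in
  [/\ (r <= N - weight p)%N,
      ctime c 0 = t /\ cnode c 0 = p,
      (forall i, (i < r)%N -> ctime c i < ctime c i.+1) /\ ctime c r <= T,
      (forall i, (i < r)%N -> cnode c i.+1 \in succ_nodes (cnode c i)) &
      ((1 <= r < N - weight p)%N -> ctime c r = T) /\
      (r = 0%N -> p = pbar N \/ t = T)].

Section Game.
Context (R : realType) (N : nat) (T : R).
(* C p p' t tau rho is only meaningful for p' in I_p, 0 <= t < tau <= T and rho
   in calL, apart from the convention cost_convention below; Ctil p t is only
   meaningful for 0 <= t <= T. *)
Variables (C : node N -> node N -> R -> R -> masses N T -> R)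
          (Ctil : node N -> R -> R).

Definition Jcost (p : node N) (t : R) (c : control R N) (rho : masses N T) : R :=
  if (p != pbar N) && (t < T) then
    \sum_(i < nswitch c)
       C (cnode c i) (cnode c i.+1) (ctime c i) (ctime c i.+1) rho
    + Ctil (cnode c (nswitch c)) (ctime c (nswitch c))
  else Ctil p t.

Definition value (p : node N) (t : R) (rho : masses N T) : R :=
  inf [set Jcost p t c rho | c in admissible T p t].

(* The set phi_{p,p'}(t). *)
Definition phi (rho : masses N T) (p p' : node N) (t : R) : set R :=
  [set tau | exists c : control R N,
    [/\ admissible T p t c,
        (1 <= nswitch c)%N,
        ctime c 1 = tau,
        cnode c 1 = p' &
        forall c' : control R N, admissible T p t c' ->
          (1 <= nswitch c')%N -> cnode c' 1 = p' ->
          Jcost p t c rho <= Jcost p t c' rho]].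

Definition cost_ge0 : Prop :=
  forall p p' t tau rho, p' \in succ_nodes p -> 0 <= t -> t < tau -> tau <= T ->
    calL rho -> 0 <= C p p' t tau rho.

Definition final_cost_regular : Prop :=
  (exists M : R, forall p t, 0 <= t <= T -> `|Ctil p t| <= M) /\
  (exists K : R, forall p s t, 0 <= s <= T -> 0 <= t <= T ->
    `|Ctil p s - Ctil p t| <= K * `|s - t|).

Definition cost_bounded_lipschitz : Prop :=
  exists2 h0 : R, 0 < h0 & forall h, 0 < h < h0 ->
    exists M K : R, forall p p' tau, p' \in succ_nodes p -> 0 < tau <= T ->
      (forall t rho, 0 <= t <= tau - h -> calL rho ->
         `|C p p' t tau rho| <= M) /\
      (forall t s rho rho', 0 <= t <= tau - h -> 0 <= s <= tau - h ->
         calL rho -> calL rho' ->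
         `|C p p' t tau rho - C p p' s tau rho'|
           <= K * (`|t - s| + L2dist rho rho')).

(* Decreasing is understood in the wide sense. *)
Definition cost_decreasing : Prop :=
  forall p p' t rho, p' \in succ_nodes p -> 0 <= t < T -> calL rho ->
    {in `]t, T] &, {homo (fun tau => C p p' t tau rho) : x y / x <= y >-> y <= x}}.

Definition cost_blowup : Prop :=
  forall M : R, exists2 delta : R, 0 < delta &
    forall p p' t tau rho, p' \in succ_nodes p -> 0 <= t -> t < tau -> tau <= T ->
      tau < t + delta -> calL rho -> M <= C p p' t tau rho.

Definition cost_continuous : Prop :=
  forall p p' t rho, p' \in succ_nodes p -> 0 <= t < T -> calL rho ->
    {in `]t, T[, continuous (fun tau => C p p' t tau rho)}.

Definition cost_convention : Prop :=
  (forall p t tau rho, 0 <= t -> t <= tau -> tau <= T -> calL rho ->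
     C p p t tau rho = 0) /\
  (forall p p' rho, p' \in succ_nodes p -> calL rho -> C p p' T T rho = 0).

Definition switch_monotone : Prop :=
  forall rho p p' t1 t2 tau1 tau2, calL rho -> p' \in succ_nodes p ->
    0 <= t1 -> t1 < t2 -> t2 < T ->
    phi rho p p' t1 tau1 -> phi rho p p' t2 tau2 ->
    tau1 < T -> tau2 < T -> tau1 < tau2.

Definition switch_single_valued : Prop :=
  forall rho p p' t, calL rho -> p != pbar N -> p' \in succ_nodes p ->
    0 <= t < T -> exists tau, phi rho p p' t = [set tau].

(* The set P_rho(p, t). *)
Definition opt_switch (rho : masses N T) (p : node N) (t : R) :
    set (node N * R) :=
  [set x : node N * R | [/\ x.1 \in succ_nodes p, t < x.2 <= T &
    forall p' t', p' \in succ_nodes p -> t < t' <= T ->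
      value x.1 x.2 rho + C p x.1 t x.2 rho
        <= value p' t' rho + C p p' t t' rho]].

(* The set Pi_j for p_j = p. A path cannot continue beyond a pair (q, s) with
   q = pbar or s = T, because opt_switch rho q s is then empty. *)
Definition opt_paths (rho : masses N T) (p : node N) : set (seq (node N * R)) :=
  [set pth : seq (node N * R) | let x i := nth (p, 0) pth i in
    [/\ (0 < size pth)%N,
        x 0%N = (p, 0),
        (forall i, (i.+1 < size pth)%N ->
           opt_switch rho (x i).1 (x i).2 (x i.+1)) &
        (x (size pth).-1).1 = pbar N \/ (x (size pth).-1).2 = T]].

(* E^pi_k(t); the default value T of the second nth implements s_{r+1} := T. *)
Definition evol (pth : seq (node N * R)) (k : node N) (t : R) : R :=
  let s i := nth T [seq x.2 | x <- pth] i in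
  [exists i : 'I_(size pth),
    (nth k [seq x.1 | x <- pth] i == k) && (s i <= t < s i.+1)]%:R.

(* The sums over opt_paths are sums over a classical set: they are meaningful
   when the summand has finite support in that set, which the normalization
   sum w = 1 enforces (the sum is 0 otherwise). *)
Definition psi (rho0 : node N -> R) (rho : masses N T) : set (masses N T) :=
  [set rho' : masses N T | exists w : seq (node N * R) -> R,
    [/\ forall j pth, opt_paths rho j pth -> 0 <= w pth,
        forall j, \sum_(pth \in opt_paths rho j) w pth = 1 &
        forall k, {ae leb0T T, forall t, rho' k t =
          \sum_(j : node N) rho0 j *
            \sum_(pth \in opt_paths rho j) w pth * evol pth k t}]].

End Game.

(* Main.v *)
(* A switch from p to q at a decision time t < T is optimal at the minimizer of
   tau |-> C(p,q,t,tau,rho) + V(q,tau,rho). Since V(q,.,rho) blows up as tau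
   tends to T (for q <> pbar) while C blows up as tau tends to t, this function
   is lower semicontinuous on compact time intervals, so uniqueness of the
   minimizer makes the optimal switching times, and by downward induction on the
   nodes also V, continuous in (t,rho) for t < T. Given a node sequence, the
   switching times are thus determined by rho, and the sequence is optimal iff
   its excess cost (>= 0, continuous in rho, 0 for some sequence) vanishes.

   The masses produced by any agent behaviour are described by finitely many
   numbers: a weight u for each initial node and node sequence, and the switching
   times. On this cube the map
     u |-> clamp (u - excess + max 0 (1 - sum u)),  times |-> optimal times
   is continuous; at a fixed point sum u >= 1 and u vanishes wherever the excess
   does not, so the weights u / sum u are supported by optimal paths: a Nash-type
   encoding which replaces Kakutani's theorem by Brouwer's.

   Brouwer's theorem comes from Kuhn's cubical lemma. For 0/1-valued labels
   l_1, ..., l_n of a grid with l_i = 0 on the face x_i = 0 and l_i = 1 on the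
   opposite face, the sum over all grid cells of the cup product
   dl_1 ... dl_n over F_2 depends, by Stokes, only on these boundary values, and
   equals 1 for the model labels; a cell with a nonzero contribution has no
   constant label. *)
Require Import Defs.
From HB Require Import structures.
From mathcomp Require Import all_boot all_order all_algebra.
From mathcomp Require Import all_classical all_reals all_analysis measurable_realfun.
From mathcomp Require Import zify ring lra.

Set Implicit Arguments.
Unset Strict Implicit.
Unset Printing Implicit Defensive.

Import Order.TTheory GRing.Theory Num.Theory.
Import numFieldNormedType.Exports.

Local Open Scope classical_set_scope.
Local Open Scope ring_scope.

(** * Kuhn's lemma *)

Section Kuhn.
Variable I : finType.

Local Notation cochain := {ffun {set I} -> 'F_2}.
Local Notation vertex := {ffun I -> nat}.

Lemma addF2K (a : 'F_2) : a + a = 0.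
Proof. by rewrite addrr_pchar2 // pchar_Fp. Qed.

Lemma F2_eq_add0 (a b : 'F_2) : a + b = 0 -> a = b.
Proof. by move=> ab; rewrite -[LHS]addr0 -(addF2K b) addrA ab add0r. Qed.

Definition corner (x : vertex) (A : {set I}) : vertex :=
  [ffun i => (x i + (i \in A))%N].

(** A set [A] stands for the vertex [corner x A] of a cube, and [up] sums over the edges leaving it
    upwards. *)
Definition up (g : cochain) : cochain :=
  [ffun A : {set I} => \sum_(s | s \notin A) g (s |: A)].

Definition wt (x : vertex) (l : vertex -> 'F_2) (h : cochain) : cochain :=
  [ffun A => l (corner x A) * h A].

(** By [wedgeE] this sums, over the edges leaving [A], the increment of [l] times [h] at the far
    end; iterated, it runs over chains of vertices. *)
Definition wedge (x : vertex) (l : vertex -> 'F_2) (h : cochain) : cochain :=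
  up (wt x l h) + wt x l (up h).

Definition wedges x ls h := foldr (wedge x) h ls.

Lemma wedgeE x l h A : wedge x l h A =
  \sum_(s | s \notin A) (l (corner x (s |: A)) + l (corner x A)) * h (s |: A).
Proof.
rewrite !ffunE big_distrr -big_split; apply: eq_bigr => s _ /=.
by rewrite ffunE mulrDl.
Qed.

Lemma upD g h : up (g + h) = up g + up h.
Proof.
apply/ffunP => A; rewrite !ffunE -big_split; apply: eq_bigr => s _ /=.
by rewrite !ffunE.
Qed.

Lemma wtD x l g h : wt x l (g + h) = wt x l g + wt x l h.
Proof. by apply/ffunP => A; rewrite !ffunE mulrDr. Qed.

Lemma wedgeD x l g h : wedge x l (g + h) = wedge x l g + wedge x l h.
Proof. by rewrite /wedge !(upD, wtD) addrACA. Qed.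

Lemma wedge0 x l : wedge x l 0 = 0.
Proof.
apply/ffunP => A; rewrite wedgeE big1 ?ffunE // => s _.
by rewrite ffunE mulr0.
Qed.

Lemma wedgesD x ls g h : wedges x ls (g + h) = wedges x ls g + wedges x ls h.
Proof. by elim: ls => //= l ls ->; rewrite wedgeD. Qed.

Lemma wedges0 x ls : wedges x ls 0 = 0.
Proof. by elim: ls => //= l ls ->; rewrite wedge0. Qed.

Lemma wedge_addl x l l' h :
  wedge x (fun v => l v + l' v) h = wedge x l h + wedge x l' h.
Proof.
apply/ffunP => A; rewrite !wedgeE [RHS]ffunE !wedgeE -big_split /=.
by apply: eq_bigr => s _; rewrite -mulrDl addrACA.
Qed.

Lemma wedges_cat x ls1 ls2 h :
  wedges x (ls1 ++ ls2) h = wedges x ls1 (wedges x ls2 h).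
Proof. exact: foldr_cat. Qed.

(** Two directions can be added in two orders with the same result, and the two terms cancel in
    F_2. *)
Lemma up_up g : up (up g) = 0.
Proof.
apply/ffunP => A; rewrite !ffunE.
transitivity (\sum_(s | s \notin A) \sum_(t | (t \notin A) && (t != s))
    g (t |: (s |: A))).
  apply: eq_bigr => s sA; rewrite ffunE; apply: eq_bigl => t.
  by rewrite in_setU1 negb_or andbC.
pose lt (s t : I) := (enum_rank s < enum_rank t)%N.
rewrite (eq_bigr (fun s => \sum_(t | (t \notin A) && lt s t) g (t |: (s |: A))
    + \sum_(t | (t \notin A) && lt t s) g (t |: (s |: A)))); last first.
  move=> s sA; rewrite (bigID (lt s)) /=; congr (_ + _); apply: eq_bigl => t.
    rewrite -andbA; congr (_ && _); rewrite /lt; case: eqVneq => // ->.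
    by rewrite ltnn.
  rewrite -andbA; congr (_ && _); rewrite /lt -leqNgt leq_eqVlt.
  by case: eqVneq => [->|ts] /=; rewrite ?ltnn // (inj_eq val_inj)
    (inj_eq enum_rank_inj) (negbTE ts).
rewrite big_split /= [X in _ + X](exchange_big_dep (fun t => t \notin A)) /=;
  last by move=> s t _ /andP[].
rewrite -big_split /= big1 // => s sA.
rewrite sA; under [X in _ + X]eq_bigr do rewrite finset.setUCA.
by rewrite addF2K.
Qed.

Lemma up_wedge x l h : up (wedge x l h) = wedge x l (up h).
Proof.
rewrite /wedge upD up_up add0r up_up.
suff -> : wt x l 0 = 0 by rewrite addr0.
by apply/ffunP => A; rewrite !ffunE mulr0.
Qed.

Lemma up_wedges x ls h : up (wedges x ls h) = wedges x ls (up h).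
Proof. by elim: ls => //= l ls IH; rewrite up_wedge IH. Qed.

Definition delta (A : {set I}) : cochain := [ffun B => (B == A)%:R].

Lemma up_deltaT : up (delta [set: I]) = \sum_s delta (~: [set s]).
Proof.
apply/ffunP => A; rewrite sum_ffunE ffunE.
rewrite [RHS](bigID (fun s => s \notin A)) /= [X in _ = _ + X]big1 ?addr0.
  apply: eq_bigr => s sA; rewrite !ffunE; congr (_%:R); congr nat_of_bool.
  apply/eqP/eqP => [sAT|->]; last by rewrite finset.setUCr.
  apply/setP => t; move/setP/(_ t): sAT; rewrite !inE.
  by case: eqVneq => [->|] //=; rewrite (negbTE sA).
move=> s /negPn sA; rewrite ffunE; case: eqP => // E.
by move: sA; rewrite E !inE eqxx.
Qed.

(** Restriction to the face raised in direction [s], indexed by the sets without [s]; this face is a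
    cube based at [corner x [set s]]. *)
Definition cut (s : I) (g : cochain) : cochain :=
  [ffun A : {set I} => if s \in A then 0 else g (s |: A)].

Lemma cut_wedge s x l h :
  cut s (wedge x l h) = wedge (corner x [set s]) l (cut s h).
Proof.
apply/ffunP => A; rewrite ffunE; case: ifPn => sA.
  rewrite wedgeE big1 // => t tA.
  by rewrite ffunE in_setU1 sA orbT mulr0.
have cE (B : {set I}) : s \notin B ->
    corner (corner x [set s]) B = corner x (s |: B).
  move=> sB; apply/ffunP => i; rewrite !ffunE !inE -addnA.
  by case: eqVneq => // ->; rewrite (negbTE sB).
rewrite !wedgeE [RHS](bigD1 s) //= [cut s h _]ffunE setU11 mulr0 add0r.
apply: eq_big => [t|t]; first by rewrite !inE negb_or andbC.
rewrite !inE negb_or => /andP[ts tA].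
have stA : s \notin t |: A by rewrite !inE negb_or eq_sym ts.
by rewrite !cE // ffunE (negbTE stA) finset.setUCA.
Qed.

Lemma cut_wedges s x ls h :
  cut s (wedges x ls h) = wedges (corner x [set s]) ls (cut s h).
Proof. by elim: ls => //= l ls IH; rewrite cut_wedge IH. Qed.

Lemma cut_deltaT s : cut s (delta [set: I]) = delta (~: [set s]).
Proof.
apply/ffunP => A; rewrite !ffunE; case: ifPn => sA.
  case: eqP => // E; by move: sA; rewrite E !inE eqxx.
congr (_%:R); congr nat_of_bool; apply/eqP/eqP => [sAT|->].
  apply/setP => t; move/setP/(_ t): sAT; rewrite !inE.
  by case: eqVneq => [->|] //=; rewrite (negbTE sA).
by rewrite finset.setUCr.
Qed.

Definition avoids (s : I) (h : cochain) := forall A : {set I}, s \in A -> h A = 0.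

Lemma wedges_avoids s x ls h : avoids s h -> avoids s (wedges x ls h).
Proof.
move=> hs; elim: ls => //= l ls IH A sA; rewrite wedgeE big1 // => t tA.
by rewrite IH ?mulr0 // in_setU1 sA orbT.
Qed.

(** Only edges inside the face not raised in direction [s] contribute, and there the increments of
    [l] vanish. *)
Lemma wedge_const s (x : vertex) l h k : avoids s h ->
  (forall v : vertex, v s = x s -> l v = k) -> wedge x l h = 0.
Proof.
move=> hs lk; apply/ffunP => A; rewrite wedgeE ffunE big1 // => t tA.
have [stA|] := boolP (s \in t |: A); first by rewrite hs ?mulr0.
rewrite in_setU1 negb_or => /andP[st sA].
rewrite !lk ?addF2K ?mul0r // !ffunE ?in_setU1.
  by rewrite (negbTE sA) addn0.
by rewrite (negbTE sA) (negbTE st) addn0.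
Qed.

(* The cup product of the coboundaries of [ls], evaluated on the cell of the
   Freudenthal triangulation of the unit cube based at [x]: a sum over the
   maximal chains of subsets of [I]. *)
Definition chi x ls : 'F_2 := wedges x ls (delta [set: I]) finset.set0.

(** Contribution of the lower [s]-face of the cube at [x], where [c] is evaluated instead of
    differenced; with base [corner x [set s]] it is that of the upper face. *)
Definition facet (ls1 : seq (vertex -> 'F_2)) c ls2 s x : 'F_2 :=
  wedges x ls1 (wt x c (wedges x ls2 (delta (~: [set s])))) finset.set0.

(* Discrete Stokes formula: over F_2, [up] is a differential ([up_up]), so
   [wedge x l], the commutator of [up] and [wt x l], commutes with it. *)
Lemma chi_facets ls1 c ls2 x : chi x (ls1 ++ c :: ls2) =
  \sum_s (facet ls1 c ls2 s (corner x [set s]) + facet ls1 c ls2 s x).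
Proof.
(* One half of the commutator moves [up] to the outside and yields the upper faces; the other moves
   it onto [delta] and yields the lower ones. *)
rewrite /chi wedges_cat /= {1}/wedge wedgesD ffunE big_split; congr (_ + _).
  rewrite -up_wedges ffunE; apply: eq_big => [s|s _]; first by rewrite inE.
  rewrite /facet -cut_deltaT -cut_wedges.
  have -> g : wt (corner x [set s]) c (cut s g) = cut s (wt x c g).
    apply/ffunP => A; rewrite !ffunE; case: ifPn => sA; first by rewrite mulr0.
    congr (c _ * _); apply/ffunP => i; rewrite !ffunE !inE -addnA.
    by case: eqVneq => // ->; rewrite (negbTE sA).
  by rewrite -cut_wedges ffunE inE.
rewrite up_wedges up_deltaT.
pose D g := wedges x ls1 (wt x c (wedges x ls2 g)).
have DD : {morph D : g h / g + h >-> g + h}.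
  by move=> g h; rewrite /D wedgesD wtD wedgesD.
have D0 : D 0 = 0.
  rewrite /D wedges0; suff -> : wt x c 0 = 0 by rewrite wedges0.
  by apply/ffunP => A; rewrite !ffunE mulr0.
by rewrite -/(D _) (big_morph D DD D0) sum_ffunE.
Qed.

(** * Labels on a grid and their total over all cells *)

Section Labels.
Variables (m' : nat).
Local Notation m := m'.+1.

Definition tame (s : I) (l : vertex -> 'F_2) :=
  (forall v : vertex, v s = 0%N -> l v = 0) /\
  (forall v : vertex, v s = m -> l v = 1).

Definition emb (x : {ffun I -> 'I_m}) : vertex := [ffun i => x i : nat].

Definition total ls := \sum_(x : {ffun I -> 'I_m}) chi (emb x) ls.

(** If the index [s] sits before or after the slot, its label is constant on the face and has no
    increments; if it is the slot itself, [c] vanishes on the face. *)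
Lemma facet_boundary js1 js2 i L1 L2 (c : vertex -> 'F_2) s (x : vertex) :
  js1 ++ i :: js2 = enum I ->
  (forall j, tame j (L1 j)) -> (forall j, tame j (L2 j)) ->
  (forall v : vertex, v i = 0%N \/ v i = m -> c v = 0) ->
  x s = 0%N \/ x s = m ->
  facet (map L1 js1) c (map L2 js2) s x = 0.
Proof.
move=> E t1 t2 c0 xs.
have dav : avoids s (delta (~: [set s])).
  move=> A sA; rewrite ffunE; case: eqP => // EA.
  by move: sA; rewrite EA !inE eqxx.
have tame_cst L : tame s L -> exists k, forall v : vertex, v s = x s -> L v = k.
  by case=> a b; case: xs => xs; [exists 0|exists 1] => v; rewrite xs; auto.
have mem_zero (L : I -> vertex -> 'F_2) js h : (forall j, tame j (L j)) ->
    s \in js -> avoids s h -> wedges x (map L js) h = 0.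
  move=> tL /path.splitPr[a b] hs; rewrite map_cat wedges_cat /=.
  have [k Lk] := tame_cst _ (tL s).
  by rewrite (wedge_const (@wedges_avoids _ _ _ _ hs) Lk) wedges0.
have wt0 : wt x c 0 = 0 by apply/ffunP => A; rewrite !ffunE mulr0.
have wtav h : avoids s h -> avoids s (wt x c h).
  by move=> hs A sA; rewrite ffunE hs ?mulr0.
have: s \in enum I by rewrite mem_enum.
rewrite -E mem_cat inE /facet => /or3P[s1|/eqP si|s2].
- by rewrite mem_zero ?ffunE //; apply: wtav; exact: wedges_avoids.
- set h := wedges x _ (delta _); suff -> : wt x c h = 0 by rewrite wedges0 ffunE.
  apply/ffunP => A; rewrite !ffunE.
  have [sA|sA] := boolP (s \in A).
    by rewrite (@wedges_avoids _ _ _ _ dav) ?mulr0.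
  by rewrite c0 ?mul0r // ffunE -si (negbTE sA) addn0.
- by rewrite [wedges x _ (delta _)]mem_zero // wt0 wedges0 ffunE.
Qed.

(** By the Stokes formula only faces contribute: inner faces belong to two cells and cancel,
    boundary faces vanish by [facet_boundary]. *)
Lemma total_slot js1 js2 i L1 L2 (c : vertex -> 'F_2) :
  js1 ++ i :: js2 = enum I ->
  (forall j, tame j (L1 j)) -> (forall j, tame j (L2 j)) ->
  (forall v : vertex, v i = 0%N \/ v i = m -> c v = 0) ->
  total (map L1 js1 ++ c :: map L2 js2) = 0.
Proof.
move=> E t1 t2 c0; rewrite /total; under eq_bigr do rewrite chi_facets.
rewrite exchange_big /= big1 // => s _; rewrite big_split /=.
(* A cyclic shift in direction [s] matches the upper face of a cell with the lower face of the next
   one; where it wraps around, both faces lie on the boundary. *)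
pose sh (x : {ffun I -> 'I_m}) : {ffun I -> 'I_m} :=
  [ffun i => if i == s then ordS (x i) else x i].
pose sh' (x : {ffun I -> 'I_m}) : {ffun I -> 'I_m} :=
  [ffun i => if i == s then ord_pred (x i) else x i].
have shK : cancel sh sh'.
  by move=> x; apply/ffunP => j; rewrite !ffunE; case: eqP => // _; rewrite ordSK.
rewrite [X in _ + X](reindex_inj (can_inj shK)) /= -big_split big1 // => x _ /=.
have bd := facet_boundary (s := s) E t1 t2 c0.
have [xm|xm] := eqVneq (x s : nat) m'.
  rewrite !bd ?addr0 // !ffunE ?inE eqxx /=.
    by left; rewrite xm modnn.
  by right; rewrite xm addn1.
suff -> : emb (sh x) = corner (emb x) [set s] by rewrite addF2K.
apply/ffunP => j; rewrite !ffunE inE; case: eqVneq => [->|]; last by rewrite addn0.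
rewrite /= modn_small ?addn1 // ltnS ltn_neqAle xm.
by rewrite -ltnS ltn_ord.
Qed.

Lemma chi_slotD ls1 l l' ls2 x :
  chi x (ls1 ++ (fun v => l v + l' v) :: ls2) =
  chi x (ls1 ++ l :: ls2) + chi x (ls1 ++ l' :: ls2).
Proof. by rewrite /chi !wedges_cat /= wedge_addl wedgesD ffunE. Qed.

(** The labels are exchanged one at a time: over F_2 the change is the total with [L1 i + L2 i] in
    slot [i], which vanishes on both [i]-faces. *)
Lemma total_invariant L1 L2 :
  (forall j, tame j (L1 j)) -> (forall j, tame j (L2 j)) ->
  total (map L2 (enum I)) = total (map L1 (enum I)).
Proof.
move=> t1 t2.
suff H js2 js1 : js1 ++ js2 = enum I ->
    total (map L1 js1 ++ map L2 js2) = total (map L1 (enum I)).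
  exact: (H (enum I) [::]).
elim: js2 js1 => [|i js2 IH] js1 E; first by rewrite cats0 -E cats0.
rewrite -(IH (rcons js1 i)) ?cat_rcons // map_rcons cat_rcons /=.
apply: F2_eq_add0; rewrite /total -big_split /=.
under eq_bigr do rewrite -chi_slotD.
apply: (total_slot E t1 t2) => v [v0|vm]; case: (t1 i) (t2 i) => a b [a' b'].
  by rewrite a ?a' ?addr0.
by rewrite b ?b' ?addF2K.
Qed.

Definition model (s : I) (v : vertex) : 'F_2 := (m <= v s)%:R.

Lemma model_tame s : tame s (model s).
Proof. by split=> v vs; rewrite /model vs ?leqnn. Qed.

(** A model label changes only along an edge in its own direction in the last layer, so at most one
    chain survives. *)
Lemma wedges_model (x : {ffun I -> 'I_m}) js (A : {set I}) h : uniq js ->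
  {in js, forall j, j \notin A} ->
  wedges (emb x) (map model js) h A =
  (all (fun j => x j == m' :> nat) js)%:R * h ([set j in js] :|: A).
Proof.
elim: js A => [|j js IH] A /=.
  by move=> _ _; rewrite mul1r; congr (h _); apply/setP => k; rewrite !inE.
move=> /andP[jjs ujs] jsA.
have jA : j \notin A by rewrite jsA ?mem_head.
have mE B : model j (corner (emb x) B) = ((x j == m' :> nat) && (j \in B))%:R.
  rewrite /model !ffunE; case: (j \in B); rewrite ?addn0 ?addn1.
    have xm : (x j <= m')%N by rewrite -ltnS.
    by rewrite ltnS andbT eqn_leq xm.
  by rewrite andbF leqNgt ltn_ord.
rewrite wedgeE (bigD1 j) //= big1 ?addr0 => [|k /andP[kA kj]]; last first.
  by rewrite !mE !in_setU1 [j == k]eq_sym (negbTE kj) addF2K mul0r.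
rewrite !mE setU11 (negbTE jA) andbT andbF addr0 IH // => [|k kjs].
  rewrite mulrA -natrM mulnb; congr (_ * h _).
  by apply/setP => k; rewrite !inE; case: (k == j); rewrite ?orbT.
rewrite in_setU1 negb_or jsA ?andbT ?inE ?kjs ?orbT //.
by apply: contra jjs => /eqP <-.
Qed.

Lemma total_model : total (map model (enum I)) = 1.
Proof.
have cE (x : {ffun I -> 'I_m}) : chi (emb x) (map model (enum I)) =
    (x == [ffun=> ord_max])%:R.
  rewrite /chi wedges_model ?enum_uniq //; last by move=> j; rewrite inE.
  rewrite ffunE finset.setU0.
  have -> : [set j in enum I] = finset.setTfor I.
    by apply/setP => j; rewrite !inE mem_enum.
  rewrite eqxx mulr1; congr (_%:R); congr nat_of_bool; apply/allP/eqP => [H|-> j _].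
    by apply/ffunP => j; apply/val_inj; rewrite ffunE; apply/eqP/H; rewrite mem_enum.
  by rewrite ffunE.
rewrite /total (bigD1 [ffun=> ord_max]) //= cE eqxx big1 ?addr0 // => x /negbTE xm.
by rewrite cE xm.
Qed.

Lemma kuhn (l : I -> {ffun I -> nat} -> bool) :
  (forall i (v : vertex), v i = 0%N -> ~~ l i v) ->
  (forall i (v : vertex), v i = m -> l i v) ->
  exists x : {ffun I -> 'I_m}, forall i, exists A B : {set I},
    ~~ l i (corner (emb x) A) /\ l i (corner (emb x) B).
Proof.
move=> l0 l1; pose L i v : 'F_2 := (l i v)%:R.
have tL j : tame j (L j).
  by split=> v vj; rewrite /L; [rewrite (negbTE (l0 _ _ vj))|rewrite l1].
have: total (map L (enum I)) != 0.
  by rewrite (total_invariant model_tame tL) total_model.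
case: (pickP (fun x : {ffun I -> 'I_m} => chi (emb x) (map L (enum I)) != 0)).
  move=> x xn _; exists x => i.
  case: (pickP (fun A : {set I} => ~~ l i (corner (emb x) A))) => [A nA|allT].
    case: (pickP (fun B : {set I} => l i (corner (emb x) B))) => [B lB|none].
      by exists A, B.
    move: xn; have: i \in enum I by rewrite mem_enum.
    move=> /path.splitPr[a b]; rewrite /chi map_cat wedges_cat /=.
    rewrite (_ : wedge _ _ _ = 0) ?wedges0 ?ffunE ?eqxx //.
    apply/ffunP => C; rewrite wedgeE ffunE big1 // => s _.
    by rewrite /L !none addr0 mul0r.
  move: xn; have: i \in enum I by rewrite mem_enum.
  move=> /path.splitPr[a b]; rewrite /chi map_cat wedges_cat /=.
  rewrite (_ : wedge _ _ _ = 0) ?wedges0 ?ffunE ?eqxx //.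
  apply/ffunP => C; rewrite wedgeE ffunE big1 // => s _.
  by rewrite /L !(negbFE (allT _)) addF2K mul0r.
move=> none; rewrite /total big1 ?eqxx // => x _.
by apply/eqP; rewrite -[_ == _]negbK none.
Qed.

End Labels.
End Kuhn.

(** * Brouwer's theorem on the cube *)

Section Brouwer.
Variables (R : realType) (I : finType).
Implicit Types x y : I -> R.

Definition unit_cube : set (I -> R) := [set x | forall i, 0 <= x i <= 1].

Definition box (x : I -> R) (d : R) : set (I -> R) :=
  [set y | unit_cube y /\ forall j, `|x j - y j| < d].

(** Neighbourhoods relative to the cube, so that continuity is only asked for inside it. *)
Definition cube_nbhs (x : I -> R) : set_system (I -> R) :=
  filter_from [set d | 0 < d] (box x).

Lemma cube_nbhs_filter x : Filter (cube_nbhs x).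
Proof.
apply: filter_from_filter; first by exists 1 => /=.
move=> d e /= d0 e0; exists (Num.min d e); first by rewrite /= lt_min d0.
by move=> y [yc yx]; split; split=> // j; have := yx j; rewrite lt_min => /andP[].
Qed.

Lemma cube_nbhs_cube x : cube_nbhs x unit_cube.
Proof. by exists 1 => //= y []. Qed.

Lemma cube_nbhs_proj x i : (fun y => y i) @ cube_nbhs x --> x i.
Proof.
have FF := cube_nbhs_filter x.
by apply/cvgrPdist_lt => e e0; exists e => // y [_]; apply.
Qed.

Lemma unit_cube_compact : compact (unit_cube : set (prod_topology (fun=> R))).
Proof.
have H := @tychonoff I (fun=> R) (fun=> `[0, 1]%classic)
  (fun=> @segment_compact R 0 1).
apply: (eq_ind _ _ H).
by rewrite predeqE => x; split=> xc i; have := xc i; rewrite /= in_itv.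
Qed.

(** Kuhn's lemma gives crossing points at every scale. Without a fixed point, near each point some
    component of [f - id] keeps a strict sign, and compactness excludes crossings at all fine
    scales. *)
Lemma brouwer (f : (I -> R) -> I -> R) :
  (forall x, unit_cube x -> unit_cube (f x)) ->
  (forall x i, unit_cube x -> (fun y => f y i) @ cube_nbhs x --> f x i) ->
  exists2 x, unit_cube x & forall i, f x i = x i.
Proof.
move=> fc fcont.
(* [crossing n x]: within 1/(n+1) of [x], each component of [f - id] takes
   both a nonnegative and a nonpositive value. *)
pose crossing (n : nat) (x : I -> R) := forall i, exists a b,
  [/\ unit_cube a, unit_cube b,
      forall j, `|x j - a j| <= n.+1%:R^-1 /\ `|x j - b j| <= n.+1%:R^-1,
      a i <= f a i & f b i <= b i].
have crossing_ex n : exists2 x, unit_cube x & crossing n x.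
  pose pt (v : {ffun I -> nat}) i : R := (v i)%:R / n.+1%:R.
  have pt_cube (v : {ffun I -> nat}) :
      (forall i, (v i <= n.+1)%N) -> unit_cube (pt v).
    move=> vn i; rewrite /pt divr_ge0 //= ler_pdivrMr ?ltr0n // mul1r.
    by rewrite ler_nat.
  (* Label 1 means that [f] does not increase coordinate [i]; the values on the two [i]-faces are
     forced, consistently with [f] mapping into the cube. *)
  pose l i (v : {ffun I -> nat}) :=
    (0 < v i)%N && ((v i == n.+1) || (f (pt v) i <= pt v i)).
  have [x xP] : exists x : {ffun I -> 'I_n.+1}, forall i, exists A B : {set I},
      ~~ l i (corner (emb x) A) /\ l i (corner (emb x) B).
    apply: kuhn => i v vi; first by rewrite /l vi.
    by rewrite /l vi eqxx.
  have cornerP A : unit_cube (pt (corner (emb x) A)).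
    apply: pt_cube => i; rewrite !ffunE.
    by rewrite (leq_trans (leq_add (leqnn _) (leq_b1 _))) // addn1.
  exists (pt (emb x)).
    by apply: pt_cube => i; rewrite ffunE ltnW.
  have close A j : `|pt (emb x) j - pt (corner (emb x) A) j| <= n.+1%:R^-1.
    rewrite /pt -mulrBl normrM [X in _ * X]ger0_norm ?invr_ge0 //.
    rewrite ler_piMl ?invr_ge0 // !ffunE; case: (j \in A).
      by rewrite natrD opprD addrA subrr add0r normrN normr1.
    by rewrite addn0 subrr normr0.
  move=> i; have [A [B [lA lB]]] := xP i.
  exists (pt (corner (emb x) A)), (pt (corner (emb x) B)); split=> //.
  - move: lA; rewrite /l negb_and -leqNgt leqn0 negb_or -ltNge.
    case/orP => [/eqP vA|/andP[_ /ltW //]].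
    by rewrite {1}/pt vA mul0r; have /andP[] := fc _ (cornerP A) i.
  - move: lB; rewrite /l => /andP[_ /orP[/eqP vB|//]].
    rewrite {2}/pt vB divff ?pnatr_eq0 //.
    by have /andP[] := fc _ (cornerP B) i.
apply: contrapT => nofix.
have nofixP x : unit_cube x -> exists i, f x i != x i.
  move=> xc; apply: contrapT => nx; apply: nofix; exists x => // i.
  by apply/eqP/negPn/negP => ne; apply: nx; exists i.
have /compact_near_coveringP cov := unit_cube_compact.
have : \forall n \near \oo, unit_cube `<=` (fun x => ~ crossing n x).
  apply: cov => x xc; have [i /eqP fxi] := nofixP x xc.
  have FF := cube_nbhs_filter x.
  have fx0 : f x i - x i != 0 by rewrite subr_eq0; exact/eqP.
  (* A positive product says that component [i] of [f - id] has the same strict sign at [y] as at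
     [x]. *)
  have [d /= d0 dP] : cube_nbhs x [set y | (f y i - y i) * (f x i - x i) > 0].
    have : (fun y => (f y i - y i) * (f x i - x i)) @ cube_nbhs x -->
        (f x i - x i) * (f x i - x i).
      apply: cvgM; last exact: cvg_cst.
      by apply: cvgB; [exact: fcont|exact: cube_nbhs_proj].
    move=> /(_ [set z | 0 < z]); apply; apply: lt_nbhsr.
    by rewrite -expr2 lt_neqAle sqr_ge0 andbT eq_sym sqrf_eq0.
  have d2 : 0 < d / 2 by rewrite divr_gt0.
  have xnear : \forall x' \near (x : prod_topology (fun=> R)),
      forall j, `|x j - x' j| < d / 2.
    have nF := @nbhs_filter (prod_topology (fun _ : I => R)) x.
    apply: (filter_forall nF) => j.
    have /cvgrPdist_lt := @proj_continuous I (fun=> R) j (x : prod_topology _).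
    exact.
  have nnear : \forall n \near \oo, (n.+1%:R^-1 : R) < d / 2.
    exact: near_infty_natSinv_lt (PosNum d2).
  exists ([set x' | forall j, `|x j - x' j| < d / 2], [set n | n.+1%:R^-1 < d / 2]).
    by split.
  move=> [x' n] [/= x'x nd] /(_ i)[a [b [ac bc ab fa fb]]].
  have near c : unit_cube c -> (forall j, `|x' j - c j| <= n.+1%:R^-1) ->
      box x d c.
    move=> cc x'c; split=> // j; rewrite -(subrK (x' j) (x j)) -addrA.
    rewrite (le_lt_trans (ler_normD _ _)) // [ltRHS]splitr ltrD //.
    exact: le_lt_trans nd.
  have /dP /= Pa : box x d a by apply: near => // j; case: (ab j).
  have /dP /= Pb : box x d b by apply: near => // j; case: (ab j).
  have := fx0; rewrite neq_lt => /orP[f0|f0].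
    by move: Pa; rewrite nmulr_lgt0 // subr_lt0 ltNge fa.
  by move: Pb; rewrite pmulr_lgt0 // subr_gt0 ltNge fb.
case=> n _ /(_ n (leqnn n)) none.
by have [x xc cx] := crossing_ex n; exact: none xc cx.
Qed.

End Brouwer.

(** * Dynamic programming *)

Section Nodes.
Variable N : nat.
Implicit Types p q : node N.

Lemma weight_le p : (weight p <= N)%N.
Proof.
rewrite -{2}(card_ord N) -sum1_card; apply: leq_sum => i _; exact: leq_b1.
Qed.

Lemma weight_succ p q : q \in succ_nodes p -> weight q = (weight p).+1.
Proof.
rewrite inE => /existsP[i /andP[pi /eqP ->]].
rewrite /weight (bigD1 i) //= [in RHS](bigD1 i) //= ffunE eqxx (negbTE pi).
rewrite add1n add0n; congr _.+1; apply: eq_bigr => j ji.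
by rewrite ffunE (negbTE ji).
Qed.

Lemma weight_pbar : weight (pbar N) = N.
Proof.
rewrite /weight (eq_bigr (fun=> 1%N)) ?sum1_card ?card_ord // => i _.
by rewrite ffunE.
Qed.

Lemma succ_neq_pbar p q : q \in succ_nodes p -> p != pbar N.
Proof.
move=> /weight_succ pq; apply/eqP => pE; have := weight_le q.
by rewrite pq pE weight_pbar ltnn.
Qed.

Lemma succ_ex p : p != pbar N -> exists q, q \in succ_nodes p.
Proof.
move=> pN; case: (pickP (fun i => ~~ p i)) => [i pi|allp].
  exists [ffun k => (k == i) || p k]; rewrite inE; apply/existsP; exists i.
  by rewrite pi eqxx.
case/eqP: pN; apply/ffunP => i; rewrite ffunE; exact: negbFE (allp i).
Qed.

Lemma weight_lt p : p != pbar N -> (weight p < N)%N.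
Proof. by move=> /succ_ex[q /weight_succ pq]; rewrite -pq weight_le. Qed.

Lemma weight_maximal p : (N <= weight p)%N -> p = pbar N.
Proof.
move=> Np; apply/eqP; apply: contraLR Np => /weight_lt.
by rewrite ltnNge.
Qed.

(** Every switch raises the weight by one, and the weight is at most [N]. *)
Lemma node_ind (P : node N -> Prop) :
  (forall p, (forall q, q \in succ_nodes p -> P q) -> P p) -> forall p, P p.
Proof.
move=> H p; have [k] := ubnP (N - weight p)%N; elim: k p => // k IH p pk.
apply: H => q qp; apply: IH; move: (weight_succ qp) (weight_le q) pk => ->.
by lia.
Qed.

End Nodes.

Section DynamicProgramming.
Variables (R : realType) (N : nat) (T : R).
Variables (C : node N -> node N -> R -> R -> masses N T -> R)
          (Ctil : node N -> R -> R).
Implicit Types (p q : node N) (t tau : R) (rho : masses N T) (c : control R N).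

(** [Jcost] without its case distinction, hence additive when a switch is prepended; both agree on
    admissible controls, which make no switch in the stopped case. *)
Definition path_cost c rho : R :=
  \sum_(i < nswitch c)
     C (cnode c i) (cnode c i.+1) (ctime c i) (ctime c i.+1) rho
  + Ctil (cnode c (nswitch c)) (ctime c (nswitch c)).

Lemma ctime_le c i : (forall i, (i < nswitch c)%N -> ctime c i < ctime c i.+1) ->
  ctime c (nswitch c) <= T -> (i <= nswitch c)%N -> ctime c i <= T.
Proof.
move=> inc rT ir; have := subnKC ir.
move: (nswitch c - i)%N => k; elim: k i ir => [|k IH] i _ iE.
  by rewrite -[i]addn0 iE.
by apply: le_trans (ltW (inc i _)) (IH i.+1 _ _); lia.
Qed.

Lemma admissible_le p t c : admissible T p t c -> t <= T.
Proof. by case=> _ [<- _] [inc rT] _ _; exact: ctime_le. Qed.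

Lemma admissible_ge1 p t c : admissible T p t c -> p != pbar N -> t < T ->
  (1 <= nswitch c)%N.
Proof.
case=> _ _ _ _ [_ r0] pN tT; rewrite lt0n; apply/eqP => /r0[pE|tE].
  by rewrite pE eqxx in pN.
by rewrite tE ltxx in tT.
Qed.

Lemma admissible_stop p t c : admissible T p t c -> p = pbar N \/ t = T ->
  nswitch c = 0%N.
Proof.
case=> rN [c0 _] [inc rT] _ _ [pE|tE].
  by move: rN; rewrite pE weight_pbar subnn leqn0 => /eqP.
case: (posnP (nswitch c)) => // r0; have := inc 0%N r0.
by rewrite c0 tE ltNge ctime_le.
Qed.

Lemma Jcost_path_cost p t c rho : admissible T p t c ->
  Jcost C Ctil p t c rho = path_cost c rho.
Proof.
move=> adm; rewrite /Jcost; case: ifPn => //; rewrite negb_and negbK -leNgt => stop.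
have c0 : nswitch c = 0%N.
  apply: (admissible_stop adm); case/orP: stop => [/eqP|Tt]; [by left|right].
  by apply/le_anti; rewrite Tt (admissible_le adm).
have [_ [t0 p0] _ _ _] := adm.
rewrite /path_cost; case: c c0 {adm} t0 p0 => r ts ns /= r0.
by subst r; rewrite big_ord0 add0r => -> ->.
Qed.

Definition ccons p t c : control R N :=
  @Control R N (nswitch c).+1 [tuple of t :: ctimes c] [tuple of p :: cnodes c].

Lemma ccons_admissible p t q tau c : q \in succ_nodes p -> t < tau ->
  admissible T q tau c -> admissible T p t (ccons p t c).
Proof.
move=> qp ttau [rN [c0 n0] [inc rT] su [stop r0]].
have wq := weight_succ qp; have := weight_le q => wN.
split=> //=.
- by rewrite /=; lia.
- split=> // -[_|i ir] /=; last exact: inc.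
  by rewrite /ctime /=; rewrite -/(ctime c 0) c0.
- move=> [_|i ir] /=; last exact: su.
  by rewrite /cnode /=; rewrite -/(cnode c 0) n0.
- split=> // rlt; rewrite /ctime /= -/(ctime c _).
  have [r1|] := posnP (nswitch c); last by move=> rpos; apply: stop; lia.
  have [qE|tE] := r0 r1; last by rewrite r1 c0 tE.
  by move: rlt wq; rewrite qE weight_pbar r1; lia.
Qed.

Lemma path_cost_ccons p t q tau c rho : admissible T q tau c ->
  path_cost (ccons p t c) rho = C p q t tau rho + path_cost c rho.
Proof.
by case=> _ [<- <-] _ _ _; rewrite /path_cost /= big_ord_recl addrA.
Qed.

Lemma admissible_uncons p t c : admissible T p t c -> (1 <= nswitch c)%N ->
  [/\ cnode c 1 \in succ_nodes p, t < ctime c 1 <= T &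
   exists2 c', admissible T (cnode c 1) (ctime c 1) c' &
    forall rho, path_cost c rho =
      C p (cnode c 1) t (ctime c 1) rho + path_cost c' rho].
Proof.
move=> adm; have c1T : (1 <= nswitch c)%N -> ctime c 1 <= T.
  by move=> r1; case: adm => _ _ [inc rT] _ _; exact: ctime_le.
case: adm => rN [t0 p0] [inc rT] su [stop r0] r1.
have qp : cnode c 1 \in succ_nodes p by rewrite -p0 su.
split=> //; first by rewrite c1T // andbT -t0 inc.
have wq := weight_succ qp; have := weight_le (cnode c 1) => wN.
case: c r1 {c1T} qp rN t0 p0 inc rT su stop r0 wq wN => -[//|r] ts ns /= _.
set c := Control _ _; rewrite {1 2 3}/c /=.
move=> qp rN t0 p0 inc rT su stop r0 wq wN.
pose c' := @Control R N r [tuple of behead ts] [tuple of behead ns].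
have tE i : ctime c' i = ctime c i.+1 by rewrite /ctime /= nth_behead.
have nE i : cnode c' i = cnode c i.+1 by rewrite /cnode /= nth_behead.
exists c'.
  split; rewrite ?tE ?nE //=; first by lia.
  - split=> // i ir; rewrite !tE; exact: inc.
  - by move=> i ir; rewrite !nE; exact: su.
  - split; first by move=> rlt; apply: stop; lia.
    (* A control with a single switch either reaches [pbar] or is too short, and then admissibility
       forces its last time to be [T]. *)
    move=> rE; have [/eqP wN'|wN'] := eqVneq (weight p).+1 N.
      by left; apply: weight_maximal; rewrite wq; lia.
    right; subst r; apply: stop; lia.
move=> rho; rewrite /path_cost /= big_ord_recl -addrA -t0 -p0; congr (_ + _).
rewrite tE nE; congr (_ + _); apply: eq_bigr => i _.
by rewrite !tE !nE.
Qed.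

Definition cstop p t : control R N := @Control R N 0 [tuple t] [tuple p].

Lemma cstop_admissible p t : t <= T -> p = pbar N \/ t = T ->
  admissible T p t (cstop p t).
Proof. by move=> tT pt; split=> //; split=> //; move=> /andP[]. Qed.

Hypothesis hsingle : switch_single_valued C Ctil.

Definition optimal_control p t rho c := [/\ admissible T p t c,
  value C Ctil p t rho = path_cost c rho &
  forall c', admissible T p t c' -> path_cost c rho <= path_cost c' rho].

(** The infimum is attained because [hsingle] makes each [phi] nonempty: this provides a best
    control for every first node, and there are finitely many of these. *)
Lemma optimal_control_ex p t rho : calL rho -> 0 <= t <= T ->
  exists c, optimal_control p t rho c.
Proof.
move=> rhoL /andP[t0 tT].
suff [c [adm cmin]] : exists c, admissible T p t c /\
    forall c', admissible T p t c' -> path_cost c rho <= path_cost c' rho.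
  exists c; split=> //; rewrite /value; apply/eqP; rewrite eq_le; apply/andP; split.
    apply: ge_inf; last by exists c => //; rewrite Jcost_path_cost.
    exists (path_cost c rho) => _ [c' adm' <-]; rewrite Jcost_path_cost //.
    exact: cmin.
  apply: lb_le_inf; first by exists (path_cost c rho), c; rewrite ?Jcost_path_cost.
  by move=> _ [c' adm' <-]; rewrite Jcost_path_cost //; exact: cmin.
have [stop|go] := pselect (p = pbar N \/ t = T).
  exists (cstop p t); split; first exact: cstop_admissible.
  move=> c' adm'; have r0 := admissible_stop adm' stop.
  have [_ [t0' p0'] _ _ _] := adm'.
  rewrite /path_cost /= big_ord0 add0r.
  case: c' r0 {adm'} t0' p0' => r ts ns /= r0; subst r.
  by rewrite big_ord0 add0r => -> ->.
have pN : p != pbar N by apply/eqP => pE; apply: go; left.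
have tltT : t < T by rewrite lt_neqAle tT andbT; apply/eqP => tE; apply: go; right.
have best q : exists c, q \in succ_nodes p -> [/\ admissible T p t c,
    cnode c 1 = q & forall c', admissible T p t c' -> (1 <= nswitch c')%N ->
      cnode c' 1 = q -> path_cost c rho <= path_cost c' rho].
  have [qp|] := boolP (q \in succ_nodes p); last by exists (cstop p t).
  have [|tau phiE] := hsingle rhoL pN qp (t := t); first by rewrite t0.
  have : phi C Ctil rho p q t tau by rewrite phiE.
  move=> [c [adm r1 _ cq cmin]]; exists c => _; split=> // c' adm' r1' cq'.
  by rewrite -!(Jcost_path_cost (p := p) (t := t)) //; exact: cmin.
have [cc ccP] := choice best.
have [q0 q0p] := succ_ex pN.
case: (Order.TotalTheory.arg_minP (fun q => path_cost (cc q) rho) q0p) => q qp qmin.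
have [adm _ _] := ccP q qp; exists (cc q); split=> // c' adm'.
have r1' := admissible_ge1 adm' pN tltT.
have [q'p _ _] := admissible_uncons adm' r1'.
apply: le_trans (qmin _ q'p) _.
by have [_ _] := ccP _ q'p; apply.
Qed.

Definition switch_cost p q t tau rho : R :=
  C p q t tau rho + value C Ctil q tau rho.

(** Bellman's principle, first half: prepend the switch to an optimal control for the rest. *)
Lemma value_le p q t tau rho : calL rho -> q \in succ_nodes p ->
  0 <= t -> t < tau <= T -> value C Ctil p t rho <= switch_cost p q t tau rho.
Proof.
move=> rhoL qp t0 /andP[ttau tauT].
have tT : t <= T by exact/ltW/(lt_le_trans ttau).
have [|c [_ cE cmin]] := @optimal_control_ex p t rho rhoL; first by rewrite t0.
have [|c' [adm' cE' _]] := @optimal_control_ex q tau rho rhoL.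
  by rewrite tauT (le_trans t0 (ltW ttau)).
rewrite /switch_cost cE cE' -(path_cost_ccons _ _ _ adm').
exact/cmin/(ccons_admissible qp ttau adm').
Qed.

(** Bellman's principle, second half: remove the first switch from an optimal control. *)
Lemma value_step p t rho : calL rho -> p != pbar N -> 0 <= t < T ->
  exists q tau, [/\ q \in succ_nodes p, t < tau <= T &
    value C Ctil p t rho = switch_cost p q t tau rho].
Proof.
move=> rhoL pN /andP[t0 tT].
have [|c [adm cE cmin]] := @optimal_control_ex p t rho rhoL.
  by rewrite t0 ltW.
have r1 := admissible_ge1 adm pN tT.
have [qp tau1 [c' adm' c'E]] := admissible_uncons adm r1.
exists (cnode c 1), (ctime c 1); split=> //; apply/le_anti.
rewrite value_le //= cE c'E /switch_cost lerD2l.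
have [|c2 [adm2 -> c2min]] := @optimal_control_ex (cnode c 1) (ctime c 1) rho rhoL.
  by case/andP: tau1 => a ->; rewrite (le_trans t0 (ltW a)).
exact: c2min.
Qed.

(** Optimizing the tail first turns the minimization over controls into one over the single time
    [tau]. *)
Lemma phiP p q t tau rho : calL rho -> q \in succ_nodes p -> 0 <= t < T ->
  phi C Ctil rho p q t tau <-> t < tau <= T /\
  forall tau', t < tau' <= T ->
    switch_cost p q t tau rho <= switch_cost p q t tau' rho.
Proof.
move=> rhoL qp /andP[t0 tT]; split.
  move=> [c [adm r1 <- cq cmin]].
  have [_ tau1 [c1 adm1 c1E]] := admissible_uncons adm r1.
  split=> // tau' /andP[tt' t'T].
  have [|c' [adm' cE' _]] := @optimal_control_ex q tau' rho rhoL.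
    by rewrite t'T (le_trans t0 (ltW tt')).
  have admc := ccons_admissible qp tt' adm'.
  have := cmin _ admc isT.
  rewrite !(Jcost_path_cost (p := p) (t := t)) // (path_cost_ccons _ _ _ adm').
  rewrite /switch_cost -cE' => H; apply: le_trans (H _); last first.
    by rewrite /cnode /=; case: adm' => _ [_ <-].
  rewrite c1E cq lerD2l; rewrite cq in adm1.
  have [|c2 [adm2 -> c2min]] := @optimal_control_ex q (ctime c 1) rho rhoL.
    by case/andP: tau1 => a ->; rewrite (le_trans t0 (ltW a)).
  exact: c2min.
move=> [/andP[ttau tauT] taumin].
have [|c [adm cE _]] := @optimal_control_ex q tau rho rhoL.
  by rewrite tauT (le_trans t0 (ltW ttau)).
have admc := ccons_admissible qp ttau adm.
exists (ccons p t c); split=> //.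
- by rewrite /ctime /=; case: adm => _ [<-].
- by rewrite /cnode /=; case: adm => _ [_ <-].
move=> c' adm' r1' cq'; rewrite !(Jcost_path_cost (p := p) (t := t)) //.
rewrite (path_cost_ccons _ _ _ adm) -cE.
have [_ tau1 [c1 adm1 ->]] := admissible_uncons adm' r1'.
rewrite cq' in adm1 *.
apply: le_trans (taumin _ tau1) _; rewrite /switch_cost lerD2l.
have [|c2 [adm2 -> c2min]] := @optimal_control_ex q (ctime c' 1) rho rhoL.
  by case/andP: tau1 => a ->; rewrite (le_trans t0 (ltW a)).
exact: c2min.
Qed.

Lemma value_stop p t rho : calL rho -> 0 <= t <= T -> p = pbar N \/ t = T ->
  value C Ctil p t rho = Ctil p t.
Proof.
move=> rhoL tT stop; have [c [adm -> _]] := @optimal_control_ex p t rho rhoL tT.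
have r0 := admissible_stop adm stop; have [_ [t0 p0] _ _ _] := adm.
rewrite /path_cost; case: c r0 {adm} t0 p0 => r ts ns /= r0; subst r.
by rewrite big_ord0 add0r => -> ->.
Qed.

Definition switch_time rho p q t : R := xget 0 (phi C Ctil rho p q t).

Lemma switch_timeP p q t rho : calL rho -> q \in succ_nodes p -> 0 <= t < T ->
  [/\ t < switch_time rho p q t <= T,
   forall tau, t < tau <= T ->
    switch_cost p q t (switch_time rho p q t) rho <= switch_cost p q t tau rho &
   forall tau, t < tau <= T ->
    switch_cost p q t tau rho <= switch_cost p q t (switch_time rho p q t) rho ->
    tau = switch_time rho p q t].
Proof.
move=> rhoL qp tT; have [s phiE] := hsingle rhoL (succ_neq_pbar qp) qp tT.
have -> : switch_time rho p q t = s.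
  by apply: xget_unique; rewrite phiE // => y.
have [sT smin] : t < s <= T /\ forall tau', t < tau' <= T ->
    switch_cost p q t s rho <= switch_cost p q t tau' rho.
  by apply/(phiP _ rhoL qp tT); rewrite phiE.
split=> // tau tauT taule.
suff : phi C Ctil rho p q t tau by rewrite phiE.
apply/(phiP _ rhoL qp tT); split=> // tau' tau'T.
exact: le_trans taule (smin _ tau'T).
Qed.

End DynamicProgramming.

(** * Continuity of the value function and of the switching times *)

Section Continuity.
Variables (R : realType) (N : nat) (T : R).
Variables (C : node N -> node N -> R -> R -> masses N T -> R)
          (Ctil : node N -> R -> R).
Implicit Types (p q : node N) (rho : masses N T).
Hypotheses (hT : 0 < T) (hC0 : cost_ge0 C) (hCtil : final_cost_regular T Ctil)
  (hClip : cost_bounded_lipschitz C) (hCdec : cost_decreasing C)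
  (hCblow : cost_blowup C) (hCcont : cost_continuous C)
  (hsingle : switch_single_valued C Ctil).

Local Notation V := (value C Ctil).
Local Notation J := (switch_cost C Ctil).
Local Notation S := (switch_time C Ctil).

Lemma final_cost_cvg (Ix : Type) (F : set_system Ix) (FF : Filter F)
    (s : Ix -> R) (s0 : R) p : 0 <= s0 <= T -> (\forall i \near F, 0 <= s i <= T) ->
  s i @[i --> F] --> s0 -> Ctil p (s i) @[i --> F] --> Ctil p s0.
Proof.
move=> s0T sT ss0; have [_ [K KP]] := hCtil.
have K0 : 0 < Num.max K 1 by rewrite lt_max ltr01 orbT.
apply/cvgrPdist_lt => e e0; near=> i.
have siT : 0 <= s i <= T by near: i.
apply: le_lt_trans (KP _ _ _ s0T siT) _.
apply: (@le_lt_trans _ _ (Num.max K 1 * `|s0 - s i|)).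
  by rewrite distrC ler_wpM2r // le_max lexx.
rewrite -ltr_pdivlMl // mulrC; near: i.
by move/cvgrPdist_lt: ss0; apply; rewrite divr_gt0.
Unshelve. all: by end_near. Qed.

Lemma value_lower_bound : exists M : R, forall p t rho, calL rho -> 0 <= t <= T ->
  - M <= V p t rho.
Proof.
have [[M MP] _] := hCtil; exists M; elim/node_ind => p IH t rho rhoL tT.
have [stop|go] := pselect (p = pbar N \/ t = T).
  rewrite (value_stop hsingle rhoL tT stop) lerNl (le_trans _ (MP p t tT)) //.
  by rewrite ler_normr lexx orbT.
have pN : p != pbar N by apply/eqP => pE; apply: go; left.
have tlt : 0 <= t < T.
  case/andP: tT => -> tT /=; rewrite lt_neqAle tT andbT.
  by apply/eqP => tE; apply: go; right.
have [q [s [qp /andP[ts sT] ->]]] := value_step hsingle rhoL pN tlt.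
case/andP: tlt => t0 _.
rewrite /J -[X in X <= _]add0r lerD //; first exact: hC0.
by apply: IH => //; rewrite sT (le_trans t0 (ltW ts)).
Qed.

(** Away from [pbar] another switch must still be made in the short time left, at a large cost. *)
Lemma value_blowup a : exists2 d : R, 0 < d & forall p t rho, p != pbar N ->
  calL rho -> 0 <= t < T -> T - d < t -> a <= V p t rho.
Proof.
have [M MP] := value_lower_bound; have [d d0 dP] := hCblow (a + M).
exists d => // p t rho pN rhoL tT td.
have [q [s [qp /andP[ts sT] ->]]] := value_step hsingle rhoL pN tT.
case/andP: tT => t0 tT.
rewrite /J -[X in X <= _](addrK M) lerD //.
  by apply: dP => //; rewrite (le_lt_trans sT) // -ltrBlDr.
by apply: MP => //; rewrite sT (le_trans t0 (ltW ts)).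
Qed.

(** The filter is arbitrary so as to cover both neighbourhoods in the cube and the product filter of
    the compactness argument in [switch_time_cvg]. *)
Definition tends (Ix : Type) (F : set_system Ix) (t : Ix -> R)
    (rho : Ix -> masses N T) (t0 : R) (rho0 : masses N T) :=
  [/\ t i @[i --> F] --> t0, \forall i \near F, 0 <= t i,
      L2dist (rho i) rho0 @[i --> F] --> (0 : R) &
      \forall i \near F, calL (rho i)].

Lemma cost_cvg_sub (Ix : Type) (F : set_system Ix) (FF : Filter F)
    (t s : Ix -> R) (rho : Ix -> masses N T) (t0 s0 : R) rho0 p q :
  q \in succ_nodes p -> calL rho0 -> 0 <= t0 -> t0 < s0 -> s0 <= T ->
  tends F t rho t0 rho0 -> s i @[i --> F] --> s0 ->
  (\forall i \near F, s i <= T) ->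
  C p q (t i) (s i) (rho i) - C p q t0 (s i) rho0 @[i --> F] --> (0 : R).
Proof.
move=> qp rho0L t00 ts0 s0T [tt0 tge0 rr0 rL] ss0 sT.
have [h0 h00 hP] := hClip.
(* If [t i] and [s i] move by less than a quarter of the gap, both [t i] and [t0] stay below
   [s i - h], where the Lipschitz bound holds uniformly in the switching time. *)
pose g := (s0 - t0) / 4; have g0 : 0 < g by rewrite divr_gt0 // subr_gt0.
pose h := Num.min (h0 / 2) g.
have h_gt0 : 0 < h by rewrite lt_min divr_gt0.
have hh0 : h < h0.
  by rewrite gt_min ltr_pdivrMr // ltr_pMr // ltr1n.
have hg : h <= g by rewrite ge_min lexx orbT.
have [M [K KP]] := hP h (introT andP (conj h_gt0 hh0)).
have gE : s0 = t0 + 4 * g by rewrite /g mulrC divfK // addrC subrK.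
apply/cvgr0Pnorm_lt => e e0.
have K0 : 0 < Num.max K 1 by rewrite lt_max ltr01 orbT.
near=> i.
have sclose : `|s0 - s i| < g by near: i; move/cvgrPdist_lt: ss0; exact.
have tclose : `|t0 - t i| < g by near: i; move/cvgrPdist_lt: tt0; exact.
have siT : s i <= T by near: i.
have ti0 : 0 <= t i by near: i.
have riL : calL (rho i) by near: i.
move: sclose tclose; rewrite 2!ltr_norml => /andP[s1 s2] /andP[t1 t2].
have [|_ KL] := KP p q (s i) qp; first by apply/andP; split=> //; lra.
have tih : 0 <= t i <= s i - h by rewrite ti0 /=; lra.
have t0h : 0 <= t0 <= s i - h by rewrite t00 /=; lra.
apply: le_lt_trans (KL _ _ _ _ tih t0h riL rho0L) _.
have d0 : 0 <= `|t i - t0| + L2dist (rho i) rho0.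
  by rewrite addr_ge0 // sqrtr_ge0.
apply: (@le_lt_trans _ _ (Num.max K 1 * (`|t i - t0| + L2dist (rho i) rho0))).
  by rewrite ler_wpM2r // le_max lexx.
rewrite -ltr_pdivlMl // mulrC [ltRHS]splitr ltrD //.
  rewrite distrC; near: i; move/cvgrPdist_lt: tt0; apply.
  by rewrite !divr_gt0.
apply: le_lt_trans (ler_norm _) _; near: i; move/cvgr0Pnorm_lt: rr0; apply.
by rewrite !divr_gt0.
Unshelve. all: by end_near. Qed.

Lemma cost_cvg_const (Ix : Type) (F : set_system Ix) (FF : Filter F)
    (t : Ix -> R) (rho : Ix -> masses N T) (t0 s0 : R) rho0 p q :
  q \in succ_nodes p -> calL rho0 -> 0 <= t0 -> t0 < s0 -> s0 <= T ->
  tends F t rho t0 rho0 ->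
  C p q (t i) s0 (rho i) @[i --> F] --> C p q t0 s0 rho0.
Proof.
move=> qp rho0L t00 ts0 s0T trr; apply/subr_cvg0.
apply: (cost_cvg_sub FF qp rho0L t00 ts0 s0T trr (s := fun=> s0)).
  exact: cvg_cst.
exact: nearW.
Qed.

Definition value_cvg p := forall (Ix : Type) (F : set_system Ix) (FF : Filter F)
    (t : Ix -> R) (rho : Ix -> masses N T) (t0 : R) rho0,
  0 <= t0 < T -> calL rho0 -> tends F t rho t0 rho0 ->
  V p (t i) (rho i) @[i --> F] --> V p t0 rho0.

Section Step.
Variables (p q : node N).
Hypotheses (qp : q \in succ_nodes p) (Vq : value_cvg q).
Variables (t0 : R) (rho0 : masses N T).
Hypotheses (t0T : 0 <= t0 < T) (rho0L : calL rho0).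

Lemma switch_cost_cvg_const (Ix : Type) (F : set_system Ix) (FF : Filter F)
    (t : Ix -> R) (rho : Ix -> masses N T) (s0 : R) :
  tends F t rho t0 rho0 -> t0 < s0 <= T ->
  J p q (t i) s0 (rho i) @[i --> F] --> J p q t0 s0 rho0.
Proof.
move=> trr /andP[ts0 s0T]; have /andP[t00 _] := t0T.
have s00 : 0 <= s0 by exact/ltW/(le_lt_trans t00).
apply: cvgD; first exact: cost_cvg_const.
have [->|sT] := eqVneq s0 T; last first.
  apply: Vq => //; first by rewrite s00 lt_neqAle sT.
  case: trr => _ _ rr0 rL; split=> //; first exact: cvg_cst.
  exact: nearW.
rewrite (value_stop hsingle rho0L) ?lexx ?ltW //; last by right.
apply: cvg_near_cst; case: trr => _ _ _; apply: filterS => i riL.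
by rewrite (value_stop hsingle riL) ?lexx ?ltW //; right.
Qed.

(** Semicontinuity with a moving switching time. For [s0 <= t0] no bound on the limit is needed,
    because the delay tends to 0 and the cost exceeds every [a]. *)
Lemma switch_cost_lsc (Ix : Type) (F : set_system Ix) (FF : Filter F)
    (t : Ix -> R) (rho : Ix -> masses N T) (s : Ix -> R) (s0 a : R) :
  tends F t rho t0 rho0 ->
  0 <= s0 <= T -> s i @[i --> F] --> s0 -> (\forall i \near F, t i < s i <= T) ->
  (t0 < s0 -> a < J p q t0 s0 rho0) ->
  \forall i \near F, a < J p q (t i) (s i) (rho i).
Proof.
move=> trr /andP[s00 s0T] ss0 tsT aJ; have [tt0 tge0 rr0 rL] := trr.
have /andP[t00 t0ltT] := t0T.
have sge0 : \forall i \near F, 0 <= s i.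
  by apply: filterS2 tge0 tsT => i ti /andP[tsi _]; exact: le_trans (ltW tsi).
have [M MP] := value_lower_bound.
have [s0t0|t0s0] := leP s0 t0.
  have [d d0 dP] := hCblow (a + 1 + M).
  near=> i.
  have /andP[tsi siT] : t i < s i <= T by near: i.
  have ti0 : 0 <= t i by near: i.
  have riL : calL (rho i) by near: i.
  apply: (@lt_le_trans _ _ (a + 1)); first by rewrite ltrDl.
  rewrite -[X in X <= _](addrK M) lerD //.
    apply: dP => //.
    have s1 : `|s0 - s i| < d / 2.
      by near: i; move/cvgrPdist_lt: ss0; apply; rewrite divr_gt0.
    have t1 : `|t0 - t i| < d / 2.
      by near: i; move/cvgrPdist_lt: tt0; apply; rewrite divr_gt0.
    move: s1 t1; rewrite 2!ltr_norml => /andP[s1 s2] /andP[t1 t2]; lra.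
  by apply: MP => //; rewrite siT (le_trans ti0 (ltW tsi)).
have {}aJ := aJ t0s0.
have [s0E|s0neT] := eqVneq s0 T; last first.
  have s0lt : s0 < T by rewrite lt_neqAle s0neT.
  suff : J p q (t i) (s i) (rho i) @[i --> F] --> J p q t0 s0 rho0.
    by move/cvgr_gt; apply.
  apply: cvgD; last by apply: Vq => //; rewrite s00.
  have c0 : C p q t0 (s i) rho0 @[i --> F] --> C p q t0 s0 rho0.
    apply: (@cvg_comp _ _ _ s (fun x => C p q t0 x rho0) F (nbhs s0)) => //.
    by apply: hCcont => //; rewrite in_itv /= t0s0.
  have sT : \forall i \near F, s i <= T.
    by apply: filterS tsT => i /andP[].
  have c1 := cost_cvg_sub FF qp rho0L t00 t0s0 s0T trr ss0 sT.
  rewrite (_ : (fun i => C p q (t i) (s i) (rho i)) = (fun i =>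
    C p q (t i) (s i) (rho i) - C p q t0 (s i) rho0 + C p q t0 (s i) rho0)).
    by rewrite -[X in _ --> X]add0r; exact: cvgD c1 c0.
  by apply/funext => i; rewrite subrK.
subst s0.
have CT := cost_cvg_const FF qp rho0L t00 t0s0 (lexx T) trr.
have VT0 q' : V q' T rho0 = Ctil q' T.
  by rewrite (value_stop hsingle rho0L) ?lexx ?ltW //; right.
(* Continuity of [C] in the switching time is given only before [T]; here monotonicity bounds [C]
   from below by its value at [T]. *)
have [qE|qN] := eqVneq q (pbar N).
  have c2 : C p q (t i) T (rho i) + Ctil q (s i) @[i --> F] --> J p q t0 T rho0.
    apply: cvgD => //; rewrite VT0; apply: final_cost_cvg => //.
      by rewrite lexx ltW.
    by apply: filterS2 sge0 tsT => i -> /andP[].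
  near=> i.
  have /andP[tsi siT] : t i < s i <= T by near: i.
  have ti0 : 0 <= t i by near: i.
  have si0 : 0 <= s i by near: i.
  have riL : calL (rho i) by near: i.
  apply: (@lt_le_trans _ _ (C p q (t i) T (rho i) + Ctil q (s i))).
    by near: i; move/cvgr_gt: c2; apply.
  rewrite /J lerD //; last first.
    by rewrite (value_stop hsingle riL) ?si0 //; left.
  apply: (hCdec qp _ riL) => //; rewrite ?in_itv /= ?tsi ?siT ?ti0 ?lexx ?andbT //.
    exact: lt_le_trans tsi siT.
  exact: lt_le_trans tsi siT.
have c2 := switch_cost_cvg_const FF trr (introT andP (conj t0s0 (lexx T))).
have [d d0 dP] := value_blowup (a + 1).
near=> i.
have /andP[tsi siT] : t i < s i <= T by near: i.
have ti0 : 0 <= t i by near: i.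
have si0 : 0 <= s i by near: i.
have riL : calL (rho i) by near: i.
(* Either the switch occurs exactly at [T], or just before it, where the value at [q] is already
   large. *)
have [siE|siN] := eqVneq (s i) T.
  by rewrite siE; near: i; move/cvgr_gt: c2; apply.
apply: (@lt_le_trans _ _ (a + 1)); first by rewrite ltrDl.
rewrite -[X in X <= _]add0r lerD //; first exact: hC0.
apply: dP => //; first by rewrite si0 lt_neqAle siN.
have : `|T - s i| < d by near: i; move/cvgrPdist_lt: ss0; apply.
by rewrite ltr_norml => /andP[_]; rewrite ltrBlDr addrC -ltrBlDr.
Unshelve. all: by end_near. Qed.

Variables (Ix : Type) (F : set_system Ix) (FF : Filter F).
Variables (t : Ix -> R) (rho : Ix -> masses N T).
Hypothesis trr : tends F t rho t0 rho0.

Lemma tends_ltT : \forall i \near F, 0 <= t i < T.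
Proof.
have [tt0 tge0 _ _] := trr; have /andP[_ tT] := t0T.
near=> i; apply/andP; split; near: i => //.
by move/cvgr_lt: tt0; apply.
Unshelve. all: by end_near. Qed.

(** By uniqueness any other time [s1] is strictly worse in the limit, and stays so near [s1] by
    semicontinuity; compactness of [0, T] leaves minimizers only near [s0]. *)
Lemma switch_time_cvg : S (rho i) p q (t i) @[i --> F] --> S rho0 p q t0.
Proof.
have [tt0 tge0 rr0 rL] := trr; have tlt := tends_ltT.
have /andP[t00 t0ltT] := t0T.
have [] := switch_timeP hsingle rho0L qp t0T.
set s0 := S rho0 p q t0 => /andP[t0s0 s0T] s0min s0uniq.
apply/cvgrPdist_lt => e e0.
have /compact_near_coveringP cov := @segment_compact R 0 T.
have : \forall i \near F, `[0, T]%classic `<=` (fun s => t i < s <= T ->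
    `|s0 - s| < e \/ J p q (t i) s0 (rho i) < J p q (t i) s (rho i)).
  apply: cov => s1; rewrite /= in_itv /= => /andP[s10 s1T].
  have [->|s1N] := eqVneq s1 s0.
    have nb : nbhs s0 [set s | `|s0 - s| < e] by exact: nbhsx_ballx.
    exists ([set s | `|s0 - s| < e], setT); first by split=> //; exact: filterT.
    by move=> [s i] [/= se _] _; left.
  have [a aJ0 aJ1] : exists2 a, J p q t0 s0 rho0 < a &
      (t0 < s1 -> a < J p q t0 s1 rho0).
    have [t0s1|s1t0] := ltP t0 s1; last first.
      by exists (J p q t0 s0 rho0 + 1); rewrite ?ltrDl.
    have lt01 : J p q t0 s0 rho0 < J p q t0 s1 rho0.
      rewrite ltNge; apply/negP => le10; move/eqP: s1N; apply.
      by apply: s0uniq; rewrite ?t0s1.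
    exists ((J p q t0 s0 rho0 + J p q t0 s1 rho0) / 2).
      by rewrite midf_lt.
    by rewrite midf_lt.
  have cst := switch_cost_cvg_const FF trr (introT andP (conj t0s0 s0T)).
  have below : \forall i \near F, J p q (t i) s0 (rho i) < a.
    by move/cvgr_lt: cst; apply.
  (* The competing time varies together with the index, restricted to the pairs at which it is
     allowed. *)
  pose G := within [set x : R * Ix | t x.2 < x.1 <= T] (filter_prod (nbhs s1) F).
  have GF : Filter G by exact: within_filter.
  have toF A : F A -> G [set x | A x.2].
    move=> FA; have H : filter_prod (nbhs s1) F [set x | A x.2].
      exact: (cvg_snd FA).
    by apply: filterS H => x Ax _.
  have trr' : tends G (fun x => t x.2) (fun x => rho x.2) t0 rho0.
    split; [|exact: (toF _ tge0)| |exact: (toF _ rL)].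
      by move=> A At; exact: (toF _ (tt0 A At)).
    by move=> A At; exact: (toF _ (rr0 A At)).
  have s1cvg : x.1 @[x --> G] --> s1.
    move=> A As1; have H : filter_prod (nbhs s1) F [set x | A x.1].
      exact: (cvg_fst As1).
    by apply: filterS H => x Ax _.
  have Gdom : \forall x \near G, t x.2 < x.1 <= T by exact: withinT.
  have s1T' : 0 <= s1 <= T by rewrite s10.
  have above := switch_cost_lsc GF trr' s1T' s1cvg Gdom aJ1.
  have above' : \forall x \near filter_prod (nbhs s1) F,
      t x.2 < x.1 <= T -> a < J p q (t x.2) x.1 (rho x.2) by exact: above.
  have below' : \forall x \near filter_prod (nbhs s1) F,
      J p q (t x.2) s0 (rho x.2) < a by exact: (cvg_snd below).
  apply: (filterS2 _ _ above' below') => x ab be tx; right.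
  exact: lt_trans be (ab tx).
move=> near_all; near=> i.
have tiT : 0 <= t i < T by near: i.
have riL : calL (rho i) by near: i.
have [siT simin _] := switch_timeP hsingle riL qp tiT.
have /andP[ti0 _] := tiT; have /andP[tsi siT'] := siT.
have H : `[0, T]%classic `<=` (fun s => t i < s <= T ->
    `|s0 - s| < e \/ J p q (t i) s0 (rho i) < J p q (t i) s (rho i)) by near: i.
have [||//|] := H (S (rho i) p q (t i)) => //.
  by rewrite /= in_itv /= siT' (le_trans ti0 (ltW tsi)).
rewrite ltNge simin // s0T andbT.
by near: i; move/cvgr_lt: tt0; apply.
Unshelve. all: by end_near. Qed.

(** The lower estimate is semicontinuity along the minimizers; the upper one tests with the fixed
    time [s0]. *)
Lemma best_cost_cvg :
  J p q (t i) (S (rho i) p q (t i)) (rho i) @[i --> F] -->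
  J p q t0 (S rho0 p q t0) rho0.
Proof.
have [tt0 tge0 rr0 rL] := trr; have tlt := tends_ltT.
have /andP[t00 t0ltT] := t0T.
have [s0T _ _] := switch_timeP hsingle rho0L qp t0T.
have cst := switch_cost_cvg_const FF trr s0T.
set s0 := S rho0 p q t0 in s0T cst *.
have sT : \forall i \near F, t i < S (rho i) p q (t i) <= T.
  near=> i; have tiT : 0 <= t i < T by near: i.
  have riL : calL (rho i) by near: i.
  by have [] := switch_timeP hsingle riL qp tiT.
have s0T' : 0 <= s0 <= T.
  by case/andP: s0T => a ->; rewrite (le_trans t00 (ltW a)).
have /andP[t0s0 s0leT] := s0T.
apply/cvgrPdist_lt => e e0.
have below : \forall i \near F, J p q t0 s0 rho0 - e <
    J p q (t i) (S (rho i) p q (t i)) (rho i).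
  apply: (switch_cost_lsc FF trr s0T' switch_time_cvg sT) => _.
  by rewrite ltrBlDr ltrDl.
have above : \forall i \near F, J p q (t i) s0 (rho i) < J p q t0 s0 rho0 + e.
  by move/cvgr_lt: cst; apply; rewrite ltrDl.
near=> i.
have tiT : 0 <= t i < T by near: i.
have riL : calL (rho i) by near: i.
have [_ simin _] := switch_timeP hsingle riL qp tiT.
rewrite distrC ltr_distl; apply/andP; split; first by near: i.
have tis0 : t i < s0 by near: i; move/cvgr_lt: tt0; apply.
apply: (le_lt_trans (simin s0 _)); last by near: i.
by rewrite tis0.
Unshelve. all: by end_near. Qed.

(** Times close to [T] but different from it would make the value at [q] blow up, while the best
    costs converge. *)
Lemma switch_time_lock : q != pbar N -> S rho0 p q t0 = T ->
  \forall i \near F, S (rho i) p q (t i) = T.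
Proof.
move=> qN s0T; have [tt0 tge0 rr0 rL] := trr; have tlt := tends_ltT.
have := best_cost_cvg; set m0 := J p q t0 _ rho0 => mcvg.
have [d d0 dP] := value_blowup (m0 + 1).
have scvg := switch_time_cvg; rewrite s0T in scvg.
near=> i.
have tiT : 0 <= t i < T by near: i.
have riL : calL (rho i) by near: i.
have [/andP[tsi siT] _ _] := switch_timeP hsingle riL qp tiT.
have /andP[ti0 _] := tiT.
apply/eqP; apply/negPn/negP => siN.
have : J p q (t i) (S (rho i) p q (t i)) (rho i) < m0 + 1.
  by near: i; move/cvgr_lt: mcvg; apply; rewrite ltrDl.
apply/negP; rewrite -leNgt -[X in X <= _]add0r lerD //; first exact: hC0.
apply: dP => //; first by rewrite (le_trans ti0 (ltW tsi)) lt_neqAle siN.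
by near: i; move/cvgr_gt: scvg; apply; rewrite ltrBlDr ltrDl.
Unshelve. all: by end_near. Qed.

End Step.

Lemma value_le_best p q t rho : calL rho -> q \in succ_nodes p -> 0 <= t < T ->
  V p t rho <= J p q t (S rho p q t) rho.
Proof.
move=> rhoL qp tT; have [sT _ _] := switch_timeP hsingle rhoL qp tT.
by apply: value_le => //; case/andP: tT.
Qed.

Lemma value_best p t rho : calL rho -> p != pbar N -> 0 <= t < T ->
  exists2 q, q \in succ_nodes p & V p t rho = J p q t (S rho p q t) rho.
Proof.
move=> rhoL pN tT; have [q [s [qp sT VE]]] := value_step hsingle rhoL pN tT.
exists q => //; apply/le_anti; rewrite value_le_best //= VE.
by have [_ smin _] := switch_timeP hsingle rhoL qp tT; exact: smin.
Qed.

(** The value is the minimum of the best costs over the finitely many successors, which all converge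
    by the induction hypothesis. *)
Lemma value_cvg_all p : value_cvg p.
Proof.
elim/node_ind: p => p IH Ix F FF t rho t0 rho0 t0T rho0L trr.
have [tt0 tge0 rr0 rL] := trr; have /andP[t00 t0ltT] := t0T.
have tlt : \forall i \near F, 0 <= t i < T by exact: (tends_ltT t0T FF trr).
have [pE|pN] := eqVneq p (pbar N).
  have t0T' : 0 <= t0 <= T by rewrite t00 ltW.
  rewrite (value_stop hsingle rho0L t0T'); last by left.
  have tleT : \forall i \near F, 0 <= t i <= T.
    by near=> i; have /andP[-> /ltW] : 0 <= t i < T by near: i.
  apply: cvg_trans; last exact: (final_cost_cvg FF t0T' tleT tt0).
  apply: near_eq_cvg; near=> i.
  have tiT : 0 <= t i <= T by near: i.
  have riL : calL (rho i) by near: i.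
  by rewrite (value_stop hsingle riL tiT) //; left.
apply/cvgrPdist_lt => e e0.
have all_close : \forall i \near F, forall q, q \in succ_nodes p ->
    `|J p q t0 (S rho0 p q t0) rho0 - J p q (t i) (S (rho i) p q (t i)) (rho i)| < e.
  apply: filter_forall => q.
  have [qp|qp] := pselect (q \in succ_nodes p).
    have := best_cost_cvg qp (IH q qp) t0T rho0L FF trr.
    by move/cvgrPdist_lt => /(_ e e0); apply: filterS => i.
  by apply: nearW => i /qp.
near=> i.
have tiT : 0 <= t i < T by near: i.
have riL : calL (rho i) by near: i.
have close : forall q, q \in succ_nodes p ->
    `|J p q t0 (S rho0 p q t0) rho0 - J p q (t i) (S (rho i) p q (t i)) (rho i)| < e.
  by near: i.
have [q0 q0p V0] := value_best rho0L pN t0T.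
have [q1 q1p V1] := value_best riL pN tiT.
have V0' := value_le_best rho0L q1p t0T.
have V1' := value_le_best riL q0p tiT.
move: (close q0 q0p) (close q1 q1p); rewrite !ltr_distl => /andP[a1 a2] /andP[b1 b2].
apply/andP; split; lra.
Unshelve. all: by end_near. Qed.

End Continuity.

(** * Distances between masses *)

Section Masses.
Variables (R : realType) (T : R).
Hypothesis T0 : 0 <= T.
Local Notation mu := (leb0T T).

Lemma leb0T_itv (a b : R) :
  (mu [set` `[Num.min a b, Num.max a b]] <= `|a - b|%:E)%E.
Proof.
have mI := @measurable_itv R `[Num.min a b, Num.max a b].
apply: (@le_trans _ _ (lebesgue_measure [set` `[Num.min a b, Num.max a b]])).
  rewrite /leb0T /= /mrestr; apply: le_measure; rewrite ?inE //.
  exact: measurableI.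
rewrite lebesgue_measure_itv /= lte_fin; case: ifPn => // _.
rewrite -EFinD lee_fin; have [ab|/ltW ba] := leP a b.
  by rewrite ler0_norm ?subr_le0 // opprB.
by rewrite ger0_norm ?subr_ge0.
Qed.

Lemma leb0T_setT : mu setT = T%:E.
Proof.
rewrite /leb0T /= /mrestr setTI lebesgue_measure_itv /= lte_fin.
case: ltP => T0'; first by rewrite -EFinD subr0.
by congr (_%:E); apply/le_anti; rewrite T0.
Qed.

Lemma abse_sqr (h : measurableTypeR R -> R) t :
  (`|(EFin \o h) t| `^ 2 = (h t ^+ 2)%:E)%E.
Proof. by rewrite /= powR_mulrn // real_normK ?num_real. Qed.

Lemma Lnorm2_le (h g : measurableTypeR R -> R) m :
  measurable_fun setT h -> measurable_fun setT g -> (forall t, 0 <= g t) ->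
  {ae mu, forall t, h t ^+ 2 <= g t} -> (\int[mu]_t (g t)%:E <= m%:E)%E ->
  fine ('N[mu]_2%:E[EFin \o h]) ^+ 2 <= m.
Proof.
move=> mh mg g0 hg gm.
have I2 : ('N[mu]_2%:E[EFin \o h] `^ 2 <= m%:E)%E.
  rewrite powR_Lnorm // (le_trans _ gm) //.
  under eq_integral do rewrite abse_sqr.
  apply: (ae_ge0_le_integral measurableT) => //.
  - by move=> t _; rewrite lee_fin sqr_ge0.
  - by apply/measurable_EFinP; exact: measurable_funX.
  - by move=> t _; rewrite lee_fin.
  - exact/measurable_EFinP.
  - by apply: filterS hg => t ht _; rewrite lee_fin.
have := Lnorm_ge0 mu 2%:E (EFin \o h).
case: ('N[mu]_2%:E[EFin \o h])%E I2 => [r|+ _|_]; last by rewrite leNgt ltNyr.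
  by rewrite poweR_EFin !lee_fin => rm r0; rewrite /= -powR_mulrn.
by rewrite poweRyr ?leye_eq.
Qed.

(** Majorant for the difference of two step functions: [c] accounts for the change of heights, each
    interval for a jump moved from [a i] to [b i]. *)
Definition step_bound (B : finType) (c : R) (a b : B -> R) (t : R) : R :=
  c + \sum_(i : B) (Num.min (a i) (b i) <= t <= Num.max (a i) (b i))%R%:R.

Lemma step_bound_measurable (B : finType) c (a b : B -> R) :
  measurable_fun setT (step_bound c a b : measurableTypeR R -> R).
Proof.
apply: measurable_funD; first exact: measurable_cst.
apply: measurable_sum => i.
rewrite (_ : (fun _ => _) = \1_([set` `[Num.min (a i) (b i), Num.max (a i) (b i)]])).
  exact: measurable_indic.
by apply/funext => t; rewrite indicE mem_setE in_itv.
Qed.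

Lemma step_bound_ge0 (B : finType) c (a b : B -> R) t : 0 <= c ->
  0 <= step_bound c a b t.
Proof. by move=> c0; rewrite addr_ge0 // sumr_ge0. Qed.

Lemma integral_step_bound (B : finType) c (a b : B -> R) : 0 <= c ->
  (\int[mu]_t (step_bound c a b t)%:E <=
    (c * T + \sum_(i : B) `|a i - b i|)%:E)%E.
Proof.
move=> c0; pose A i := [set` `[Num.min (a i) (b i), Num.max (a i) (b i)]].
have mA i : measurable (A i : set (measurableTypeR R)) by exact: measurable_itv.
rewrite (_ : (fun t => _) = (fun t =>
    (cst c%:E t + \sum_(i <- index_enum B) (\1_(A i) t)%:E)%E)); last first.
  apply/funext => t; rewrite /step_bound EFinD sumEFin; congr (_ + _%:E)%E.
  by apply: eq_bigr => i _; rewrite indicE mem_setE in_itv.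
rewrite ge0_integralD //=; last 2 first.
- by move=> t _; apply: sume_ge0 => i _; rewrite lee_fin.
- by apply: emeasurable_sum => i; apply/measurable_EFinP; exact: measurable_indic.
rewrite integral_cst // leb0T_setT EFinD -EFinM leeD2l //.
rewrite ge0_integral_sum //; last first.
  by move=> i; apply/measurable_EFinP; exact: measurable_indic.
rewrite -sumEFin; apply: lee_sum => i _.
by rewrite integral_indic // setIT; exact: leb0T_itv.
Qed.

Lemma Lspace_ex (f : measurableTypeR R -> R) : measurable_fun setT f ->
  (forall t, 0 <= f t <= 1) ->
  exists g : LspaceType2 mu, {ae mu, forall t, g t = f t}.
Proof.
move=> mf f01.
pose f1 : {mfun measurableTypeR R >-> measurableTypeR R} :=
  HB.pack f
    (@isMeasurableFun.Build _ _ (measurableTypeR R) (measurableTypeR R) f mf).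
pose g1 : {mfun_ mu, measurableTypeR R >-> measurableTypeR R} :=
  (\pi_({mfun_ mu, measurableTypeR R >-> measurableTypeR R}) f1)%qT.
have gf : {ae mu, forall t, g1 t = f t}.
  have : (repr g1 == f1
      %[mod {mfun_ mu, measurableTypeR R >-> measurableTypeR R}])%qT.
    by rewrite reprK.
  by rewrite eqmodE => /asboolP; apply: filterS => t /(_ I).
have mg1 : measurable_fun setT (g1 : measurableTypeR R -> R).
  exact: (@measurable_funPT _ _ (measurableTypeR R) (measurableTypeR R) (repr g1)).
have fin : finite_norm mu 2%:E (g1 : measurableTypeR R -> R).
  rewrite /finite_norm unlock; apply: poweR_lty.
  apply: (@le_lt_trans _ _ (\int[mu]_t (cst 1%:E t)))%E; last first.
    by rewrite integral_cst // leb0T_setT mul1e ltry.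
  under eq_integral do rewrite abse_sqr.
  apply: (ae_ge0_le_integral measurableT) => //.
  - by move=> t _; rewrite lee_fin sqr_ge0.
  - by apply/measurable_EFinP; exact: measurable_funX.
  - apply: filterS gf => t ht _; have /andP[f0 f1'] := f01 t.
    by rewrite lee_fin ht expr_le1.
exists (HB.pack_for (LspaceType mu (lee1n 2)) g1
  (@isFinLebesgue.Build _ _ _ mu 2%:E (lee1n 2) g1 fin)).
exact: gf.
Qed.

Lemma Lspace_measurable (g : LspaceType2 mu) :
  measurable_fun setT (g : measurableTypeR R -> R).
Proof.
exact: (@measurable_funPT _ _ (measurableTypeR R) (measurableTypeR R)
  (repr (g : {mfun_ mu, measurableTypeR R >-> measurableTypeR R}))).
Qed.

Section Distance.
Variables (N : nat) (B : finType).

(** For values in [0, 1] the square of a difference is at most its modulus, so an integral bound on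
    the majorant suffices. *)
Lemma L2dist_le (rho rho' : masses N T) (f f' : node N -> R -> R) c (a b : B -> R) :
  (forall k, {ae mu, forall t, rho k t = f k t}) ->
  (forall k, {ae mu, forall t, rho' k t = f' k t}) ->
  (forall k t, 0 <= f k t <= 1) -> (forall k t, 0 <= f' k t <= 1) ->
  0 <= c -> (forall k t, `|f k t - f' k t| <= step_bound c a b t) ->
  L2dist rho rho' <=
    Num.sqrt (#|{: node N}|%:R * (c * T + \sum_(i : B) `|a i - b i|)).
Proof.
move=> rf rf' f01 f01' c0 ff'; rewrite /L2dist ler_wsqrtr //.
rewrite mulr_natl -sumr_const ler_sum // => k _.
apply: (Lnorm2_le (g := step_bound c a b)).
- by apply: measurable_funB; exact: Lspace_measurable.
- exact: step_bound_measurable.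
- by move=> t; exact: step_bound_ge0.
- have := rf k; have := rf' k; apply: filterS2 => t -> ->.
  apply: le_trans (ff' k t); rewrite -real_normK ?num_real // expr2.
  rewrite ler_piMl // ler_norml; have := f01 k t; have := f01' k t.
  by move=> /andP[? ?] /andP[? ?]; apply/andP; split; lra.
- exact: integral_step_bound.
Qed.

End Distance.
End Masses.

(** * Node sequences and the paths they induce *)

Section Evolution.
Variables (R : realType) (N : nat) (T : R).
Implicit Types (pth : seq (node N * R)) (k : node N) (t : R).

(** Recursive form of [evol]; the default [T] of [head] closes the last interval. *)
Fixpoint occupies pth k t : bool :=
  if pth is (p, s) :: pth' then
    (p == k) && (s <= t < head T [seq x.2 | x <- pth']) || occupies pth' k t
  else false.

Lemma evolE pth k t : evol T pth k t = (occupies pth k t)%:R.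
Proof.
congr (_%:R); congr nat_of_bool; elim: pth => [|[p s] pth IH].
  by apply/existsP => -[[]].
rewrite [RHS]/= -{}IH.
apply/existsP/orP => [[[[|i] /= ilt]]|[|/existsP[i]]].
- by move=> H; left; rewrite -nth0.
- by move=> H; right; apply/existsP; exists (Ordinal (ilt : (i < size pth)%N)).
- by rewrite -nth0 => H; exists ord0.
- by move=> H; exists (lift ord0 i).
Qed.

Lemma occupies_measurable pth k :
  measurable_fun setT (fun t : measurableTypeR R => (occupies pth k t)%:R : R).
Proof.
elim: pth => [|[p s] pth IH] /=; first exact: measurable_cst.
set s' := head _ _.
(* Inclusion-exclusion for the disjunction. *)
rewrite (_ : (fun t => _) = (fun t =>
    (p == k)%:R * \1_[set` `[s, s'[] t + (occupies pth k t)%:R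
    - (p == k)%:R * \1_[set` `[s, s'[] t * (occupies pth k t)%:R)).
  have m1 : measurable_fun setT (fun t : measurableTypeR R =>
      (p == k)%:R * (\1_[set` `[s, s'[] t : R)).
    by apply: measurable_funM => //; exact: measurable_indic.
  apply: measurable_funB; first exact: measurable_funD.
  exact: measurable_funM.
apply/funext => t; rewrite indicE mem_setE in_itv /=.
by case: (p == k); case: (s <= t < s'); case: occupies;
  rewrite /= ?(mul0r, mulr0, mul1r, mulr1, addr0, add0r, subr0, addrK, oppr0).
Qed.

(** The nodes occupied at [t] depend on the times only through which of them have passed. *)
Lemma occupies_eq (ns : seq (node N)) (ss ss' : seq R) k t :
  size ss = size ns -> size ss' = size ns ->
  (forall i, (i < size ns)%N -> (nth T ss i <= t) = (nth T ss' i <= t)) ->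
  occupies (zip ns ss) k t = occupies (zip ns ss') k t.
Proof.
elim: ns ss ss' => [|n ns IH] [|s ss] [|s' ss'] //= [sz] [sz'] H.
rewrite (H 0%N) // (IH ss ss') //; last by move=> i; exact: (H i.+1).
congr (_ && (_ && _) || _); rewrite !ltNge.
case: ns ss ss' sz sz' H {IH} => [|n' ns] [|s1 ss] [|s1' ss'] //= _ _ H.
by rewrite (H 1%N).
Qed.

End Evolution.

(** * Routes along node sequences with optimal switching times *)

Section Routes.
Variables (R : realType) (N : nat) (T : R).
Variables (C : node N -> node N -> R -> R -> masses N T -> R)
          (Ctil : node N -> R -> R).
Implicit Types (p q : node N) (rho : masses N T) (l : seq (node N)).
Hypotheses (hT : 0 < T) (hC0 : cost_ge0 C) (hCtil : final_cost_regular T Ctil)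
  (hClip : cost_bounded_lipschitz C) (hCdec : cost_decreasing C)
  (hCblow : cost_blowup C) (hCcont : cost_continuous C)
  (hsingle : switch_single_valued C Ctil).

Local Notation V := (value C Ctil).
Local Notation J := (switch_cost C Ctil).
Local Notation S := (switch_time C Ctil).

Definition halted p (t : R) := (p == pbar N) || (t == T).

(** Sending stopped and forbidden switches to [T] gives every node sequence a full list of times. *)
Definition next_time rho p q t : R :=
  if halted p t || (q \notin succ_nodes p) then T else S rho p q t.

Definition step_excess rho p q t : R :=
  if halted p t then 0 else
  if q \in succ_nodes p then J p q t (S rho p q t) rho - V p t rho else 1.

Fixpoint times rho p t l : seq R :=
  if l is q :: l' then
    next_time rho p q t :: times rho q (next_time rho p q t) l'
  else [::].

(* By telescoping, the amount by which the cost of following [l] with optimal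
   switching times exceeds the optimal cost; the penalty 1 rules out forbidden
   switches. *)
Fixpoint excess rho p t l : R :=
  if l is q :: l' then
    step_excess rho p q t + excess rho q (next_time rho p q t) l'
  else 0.

(** Node sequences will have fixed length [N]; what follows a stop or a forbidden switch is padding
    and is cut off. *)
Fixpoint route rho p t l : seq (node N * R) :=
  (p, t) :: if l is q :: l' then
    if halted p t || (q \notin succ_nodes p) then [::]
    else route rho q (next_time rho p q t) l'
  else [::].

Lemma not_halted p t : 0 <= t <= T -> ~~ halted p t -> p != pbar N /\ 0 <= t < T.
Proof.
by move=> /andP[t0 tT]; rewrite negb_or => /andP[-> tN]; rewrite t0 lt_neqAle tN.
Qed.

Lemma next_time_le rho p q t : calL rho -> 0 <= t <= T ->
  0 <= next_time rho p q t <= T.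
Proof.
move=> rhoL tT; rewrite /next_time; case: ifPn => [_|].
  by rewrite lexx ltW.
rewrite negb_or negbK => /andP[/(not_halted tT)[pN tlt] qp].
have [/andP[a ->] _ _] := switch_timeP hsingle rhoL qp tlt.
by case/andP: tT => t0 _; rewrite (le_trans t0 (ltW a)).
Qed.

Lemma size_times rho p t l : size (times rho p t l) = size l.
Proof. by elim: l p t => //= q l IH p t; rewrite IH. Qed.

Lemma times_le rho p t l i : calL rho -> 0 <= t <= T ->
  0 <= nth T (times rho p t l) i <= T.
Proof.
move=> rhoL; elim: l p t i => [|q l IH] p t [|i] tT /=; rewrite ?lexx ?(ltW hT) //.
  exact: next_time_le.
by apply: IH; exact: next_time_le.
Qed.

Lemma step_excess_ge0 rho p q t : calL rho -> 0 <= t <= T ->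
  0 <= step_excess rho p q t.
Proof.
move=> rhoL tT; rewrite /step_excess; case: ifPn => // /(not_halted tT)[pN tlt].
by case: ifPn => // qp; rewrite subr_ge0 value_le_best.
Qed.

Lemma excess_ge0 rho p t l : calL rho -> 0 <= t <= T -> 0 <= excess rho p t l.
Proof.
move=> rhoL; elim: l p t => //= q l IH p t tT.
by rewrite addr_ge0 ?step_excess_ge0 // IH // next_time_le.
Qed.

Lemma excess_halted rho p t l : halted p t -> excess rho p t l = 0.
Proof.
elim: l p t => //= q l IH p t h; rewrite /step_excess /next_time h add0r.
by apply: IH; rewrite /halted eqxx orbT.
Qed.

Lemma excess0_ex rho p t n : calL rho -> 0 <= t <= T -> (N - weight p <= n)%N ->
  exists2 l, size l = n & excess rho p t l = 0.
Proof.
move=> rhoL; elim: n p t => [|n IH] p t tT pn.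
  exists [::] => //.
have [h|/[dup] h /(not_halted tT)[pN tlt]] := boolP (halted p t).
  by exists (nseq n.+1 p); rewrite ?size_nseq // excess_halted.
have [q qp VE] := value_best hsingle rhoL pN tlt.
have tT' := next_time_le p q rhoL tT.
have [||l ln l0] := IH q (next_time rho p q t) => //.
  by move: pn; rewrite (weight_succ qp); lia.
exists (q :: l); first by rewrite /= ln.
by rewrite /= l0 addr0 /step_excess (negbTE h) qp -VE subrr.
Qed.

Lemma route_head rho p t l : exists r, route rho p t l = (p, t) :: r.
Proof. by case: l => [|q l] /=; eexists. Qed.

(** A vanishing sum of nonnegative excesses makes every switch optimal; the length of [l] ensures
    that [pbar] is reached unless time [T] comes first. *)
Lemma route_optimal rho p t l : calL rho -> 0 <= t <= T ->
  (N - weight p <= size l)%N -> excess rho p t l = 0 ->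
  (forall d i, (i.+1 < size (route rho p t l))%N ->
     opt_switch C Ctil rho (nth d (route rho p t l) i).1
       (nth d (route rho p t l) i).2 (nth d (route rho p t l) i.+1)) /\
  (forall d, (last d (route rho p t l)).1 = pbar N \/
             (last d (route rho p t l)).2 = T).
Proof.
move=> rhoL; elim: l p t => [|q l IH] p t tT pl.
  by move=> _ /=; split=> // _; left; apply: weight_maximal; move: pl => /=; lia.
have tT' := next_time_le p q rhoL tT.
move=> /= /eqP; rewrite paddr_eq0 ?step_excess_ge0 ?excess_ge0 //.
rewrite /step_excess; have [h _|h] := boolP (halted p t).
  by split=> // _ /=; case/orP: h => /eqP; [left|right].
have [pN tlt] := not_halted tT h.
case: ifPn => [qp|]; last by rewrite oner_eq0.
rewrite subr_eq0 => /andP[/eqP VE /eqP l0] /=.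
have [|opt stop] := IH q (next_time rho p q t) tT' _ l0.
  by move: pl => /=; rewrite (weight_succ qp); lia.
have nE : next_time rho p q t = S rho p q t.
  by rewrite /next_time (negbTE h) qp.
split; last first.
  move=> d; have := stop (p, t).
  by have [r ->] := route_head rho q (next_time rho p q t) l.
move=> d [|i] /=; last by move=> ilt; exact: opt.
have [r ->] /= := route_head rho q (next_time rho p q t) l.
move=> _; rewrite nE; have [sT _ _] := switch_timeP hsingle rhoL qp tlt.
split=> // p' t' p'p t'T; rewrite addrC [leRHS]addrC -/(J _ _ _ _ _) VE.
by apply: value_le => //; case/andP: tlt.
Qed.

Lemma occupies_end rho q l k t :
  occupies T (zip (q :: l) (T :: times rho q T l)) k t = false.
Proof.
have TT : (T <= t < T) = false by case: (leP T t).
elim: l q => [|q' l IH] q /=; first by rewrite TT andbF.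
have E : next_time rho q q' T = T by rewrite /next_time /halted eqxx orbT.
by rewrite E; have /= -> := IH q'; rewrite TT andbF.
Qed.

(** Padding nodes are entered at [T] and occupy the empty interval [T, T[, so cutting them off
    changes nothing. *)
Lemma occupies_route rho p t l k s :
  occupies T (route rho p t l) k s =
  occupies T (zip (p :: l) (t :: times rho p t l)) k s.
Proof.
elim: l p t => [|q l IH] p t //=.
case: ifPn => h.
  have E : next_time rho p q t = T by rewrite /next_time h.
  by rewrite E; have /= -> := occupies_end rho q l k s.
have /= <- := IH q (next_time rho p q t).
by have [r ->] := route_head rho q (next_time rho p q t) l.
Qed.

Section Limits.
Variables (Ix : Type) (F : set_system Ix) (FF : Filter F).
Variables (rho : Ix -> masses N T) (rho0 : masses N T).
Hypotheses (rho0L : calL rho0) (rL : \forall i \near F, calL (rho i))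
  (rr0 : L2dist (rho i) rho0 @[i --> F] --> (0 : R)).

(* Away from [pbar] the value function blows up at [T] but is finite at [T]
   itself, so convergence is only stable if a limit time [T] is attained. *)
Definition locked p (t : Ix -> R) (t0 : R) := [/\ 0 <= t0 <= T,
  t i @[i --> F] --> t0, \forall i \near F, 0 <= t i <= T &
  p != pbar N -> t0 = T -> \forall i \near F, t i = T].

Lemma locked_tends p t t0 : locked p t t0 -> tends F t rho t0 rho0.
Proof.
by case=> _ tt0 tT _; split=> //; apply: filterS tT => i /andP[].
Qed.

Lemma locked_halted p t t0 : locked p t t0 ->
  \forall i \near F, halted p (t i) = halted p t0.
Proof.
move=> [/andP[t00 t0T] tt0 tT lock]; rewrite /halted.
have [pE|pN] /= := eqVneq p (pbar N); first exact: nearW.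
have [t0E|t0N] := eqVneq t0 T.
  by apply: filterS (lock pN t0E) => i ->; rewrite eqxx.
have : \forall i \near F, t i < T.
  by move/cvgr_lt: tt0; apply; rewrite lt_neqAle t0N.
by apply: filterS => i /lt_eqF ->.
Qed.

(** The switching time converges by [switch_time_cvg] and attains a limit [T] by [switch_time_lock];
    after a stop or a forbidden switch it is constantly [T]. *)
Lemma locked_step p q t t0 : locked p t t0 ->
  locked q (fun i => next_time (rho i) p q (t i)) (next_time rho0 p q t0).
Proof.
move=> lk; have hh := locked_halted lk; have trr := locked_tends lk.
have [t0T tt0 tT _] := lk.
have nT : \forall i \near F, 0 <= next_time (rho i) p q (t i) <= T.
  by apply: filterS2 rL tT => i; exact: next_time_le.
have n0T := next_time_le p q rho0L t0T.
have [h|] := boolP (halted p t0 || (q \notin succ_nodes p)).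
  have nE : \forall i \near F, next_time (rho i) p q (t i) = T.
    by apply: filterS hh => i hi; rewrite /next_time hi h.
  have n0E : next_time rho0 p q t0 = T by rewrite /next_time h.
  by split=> //; rewrite n0E; exact: cvg_near_cst.
rewrite negb_or negbK => /andP[h qp].
have [pN t0lt] := not_halted t0T h.
have nE : \forall i \near F, S (rho i) p q (t i) = next_time (rho i) p q (t i).
  by apply: filterS hh => i hi; rewrite /next_time hi (negbTE h) qp.
have n0E : next_time rho0 p q t0 = S rho0 p q t0 by rewrite /next_time (negbTE h) qp.
have Vq := value_cvg_all hT hC0 hCtil hClip hCdec hCblow hCcont hsingle (p := q).
split=> //.
  rewrite n0E; apply: cvg_trans (near_eq_cvg nE) _.
  exact: (switch_time_cvg hT hC0 hCtil hClip hCdec hCblow hCcont hsingle qp Vq t0lt).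
rewrite n0E => qN sT.
have := switch_time_lock hT hC0 hCtil hClip hCdec hCblow hCcont hsingle
  qp Vq t0lt rho0L FF trr qN sT.
by apply: filterS2 nE => i ->.
Qed.

Lemma times_cvg p t t0 l i : locked p t t0 ->
  nth T (times (rho y) p (t y) l) i @[y --> F] --> nth T (times rho0 p t0 l) i.
Proof.
elim: l p t t0 i => [|q l IH] p t t0 [|i] lk /=; try exact: cvg_cst.
  by have [] := locked_step q lk.
by apply: (IH q (fun y => next_time (rho y) p q (t y))); exact: locked_step.
Qed.

Lemma step_excess_cvg p q t t0 : locked p t t0 ->
  step_excess (rho y) p q (t y) @[y --> F] --> step_excess rho0 p q t0.
Proof.
move=> lk; have hh := locked_halted lk; have trr := locked_tends lk.
have [t0T tt0 tT _] := lk.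
pose g y := if halted p t0 then 0 else if q \in succ_nodes p then
  J p q (t y) (S (rho y) p q (t y)) (rho y) - V p (t y) (rho y) else 1.
have gE : \forall y \near F, g y = step_excess (rho y) p q (t y).
  by apply: filterS hh => y hy; rewrite /step_excess hy.
apply: cvg_trans (near_eq_cvg gE) _.
rewrite /g /step_excess; case: ifPn => [_|h]; first exact: cvg_cst.
case: ifPn => [qp|_]; last exact: cvg_cst.
have [pN t0lt] := not_halted t0T h.
have Vc p' := value_cvg_all hT hC0 hCtil hClip hCdec hCblow hCcont hsingle (p := p').
apply: cvgB; last exact: Vc.
exact: (best_cost_cvg hT hC0 hCtil hClip hCdec hCblow hCcont hsingle qp (Vc q) t0lt).
Qed.

Lemma excess_cvg p t t0 l : locked p t t0 ->
  excess (rho y) p (t y) l @[y --> F] --> excess rho0 p t0 l.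
Proof.
elim: l p t t0 => [|q l IH] p t t0 lk /=; first exact: cvg_cst.
apply: cvgD; first exact: step_excess_cvg.
by apply: (IH q (fun y => next_time (rho y) p q (t y))); exact: locked_step.
Qed.

End Limits.
End Routes.

(** * Masses generated by weights and switching times *)

Section RealLimits.
Variables (R : realType) (Ix : Type) (F : set_system Ix) (FF : Filter F).

Lemma sum_cvg (B : finType) (f : B -> Ix -> R) (a : B -> R) :
  (forall b, f b i @[i --> F] --> a b) ->
  \sum_b f b i @[i --> F] --> \sum_b a b.
Proof.
by move=> fa; apply: cvg_big => [|b _]; [exact: add_continuous|exact: fa].
Qed.

Lemma sum_cvg0 (B : finType) (f : B -> Ix -> R) :
  (forall b, f b i @[i --> F] --> (0 : R)) -> \sum_b f b i @[i --> F] --> (0 : R).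
Proof.
by move=> f0; have := sum_cvg (a := fun=> 0) f0; rewrite big1.
Qed.

Lemma max_cvg (f g : Ix -> R) a b : f i @[i --> F] --> a -> g i @[i --> F] --> b ->
  Num.max (f i) (g i) @[i --> F] --> Num.max a b.
Proof.
move=> fa gb; rewrite maxr_absE; under eq_cvg do rewrite maxr_absE.
apply: cvgM; last exact: cvg_cst.
by apply: cvgD; [exact: cvgD|apply: cvg_norm; exact: cvgB].
Qed.

Lemma min_cvg (f g : Ix -> R) a b : f i @[i --> F] --> a -> g i @[i --> F] --> b ->
  Num.min (f i) (g i) @[i --> F] --> Num.min a b.
Proof.
move=> fa gb; rewrite minr_absE; under eq_cvg do rewrite minr_absE.
apply: cvgM; last exact: cvg_cst.
by apply: cvgB; [exact: cvgD|apply: cvg_norm; exact: cvgB].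
Qed.

End RealLimits.

Section Parametrization.
Variables (R : realType) (N : nat) (T : R) (rho0 : node N -> R).
Hypotheses (hT : 0 < T) (hrho0 : forall j, 0 <= rho0 j)
  (hrho0sum : \sum_(j : node N) rho0 j <= 1).

Local Notation plan := (N.-tuple (node N)).
(* The unknowns: an unnormalized weight for every initial node and node
   sequence, and the (rescaled) switching times along that sequence. *)
Definition unknown : finType :=
  ((node N * plan) + (node N * plan * 'I_N))%type.
Implicit Types (x y : unknown -> R) (jl : node N * plan).

Definition raw_total x j : R := \sum_(l : plan) x (inl (j, l)).

(** The denominator keeps this continuous on the whole cube; the shares of a node sum to 1 as soon
    as its raw total is at least 1. *)
Definition share x jl : R := x (inl jl) / Num.max 1 (raw_total x jl.1).

Definition plan_times x jl : seq R := [seq T * x (inr (jl, i)) | i <- enum 'I_N].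

Definition trace x jl := zip (jl.1 :: jl.2) (0 :: plan_times x jl).

Definition mass x k t : R :=
  \sum_(j : node N) rho0 j *
    \sum_(l : plan) share x (j, l) * (occupies T (trace x (j, l)) k t)%:R.

Lemma rho0_le1 j : rho0 j <= 1.
Proof.
apply: le_trans hrho0sum; rewrite (bigD1 j) //= lerDl.
by apply: sumr_ge0 => i _.
Qed.

Lemma max1_gt0 (a : R) : 0 < Num.max 1 a.
Proof. by rewrite lt_max ltr01. Qed.

Lemma share_ge0 x jl : unit_cube x -> 0 <= share x jl.
Proof.
by move=> xc; rewrite divr_ge0 ?(ltW (max1_gt0 _)) //; case/andP: (xc (inl jl)).
Qed.

Lemma share_sum_le1 x j : unit_cube x -> \sum_(l : plan) share x (j, l) <= 1.
Proof.
move=> xc; rewrite /share /= -mulr_suml ler_pdivrMr ?max1_gt0 // mul1r.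
by rewrite le_max lexx orbT.
Qed.

Lemma share_le1 x jl : unit_cube x -> share x jl <= 1.
Proof.
move=> xc; case: jl => j l; apply: le_trans (share_sum_le1 j xc).
rewrite (bigD1 l) //= lerDl; apply: sumr_ge0 => i _; exact: share_ge0.
Qed.

Lemma mass01 x k t : unit_cube x -> 0 <= mass x k t <= 1.
Proof.
move=> xc; apply/andP; split.
  apply: sumr_ge0 => j _; rewrite mulr_ge0 //; apply: sumr_ge0 => l _.
  by rewrite mulr_ge0 ?share_ge0.
apply: le_trans hrho0sum; apply: ler_sum => j _.
rewrite ler_piMr //; apply: le_trans (share_sum_le1 j xc).
by apply: ler_sum => l _; rewrite ler_piMr ?share_ge0 // lern1 leq_b1.
Qed.

Lemma mass_measurable x k :
  measurable_fun setT (mass x k : measurableTypeR R -> R).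
Proof.
apply: measurable_sum => j; apply: measurable_funM; first exact: measurable_cst.
apply: measurable_sum => l; apply: measurable_funM; first exact: measurable_cst.
exact: occupies_measurable.
Qed.

Lemma size_plan_times x jl : size (plan_times x jl) = N.
Proof. by rewrite size_map size_enum_ord. Qed.

Lemma nth_plan_times x jl (i : 'I_N) :
  nth T (plan_times x jl) i = T * x (inr (jl, i)).
Proof. by rewrite (nth_map i) ?size_enum_ord // nth_ord_enum. Qed.

(** If the occupations differ, [t] separates two corresponding times and lies in the interval
    between them. *)
Lemma occupies_dist x y jl k t :
  `|(occupies T (trace x jl) k t)%:R - (occupies T (trace y jl) k t)%:R| <=
  \sum_(i < N) (Num.min (T * x (inr (jl, i))) (T * y (inr (jl, i))) <= t <=
                Num.max (T * x (inr (jl, i))) (T * y (inr (jl, i))))%R%:R :> R.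
Proof.
set b := (X in _ <= \sum_i X i).
have b0 i : 0 <= b i by [].
case: (pickP (fun i : 'I_N =>
    (T * x (inr (jl, i)) <= t) != (T * y (inr (jl, i)) <= t))) => [i xy|same].
  apply: (@le_trans _ _ 1).
    by case: occupies; case: occupies;
      rewrite ?(subrr, subr0, sub0r, normrN, normr0, normr1).
  rewrite (bigD1 i) //= -[leLHS]addr0 lerD //; last by apply: sumr_ge0.
  rewrite /b ge_min le_max; move: xy.
  by case: (leP (T * x _) t) => a1; case: (leP (T * y _) t) => a2 //= _;
    rewrite ?(ltW a1) ?(ltW a2) ?orbT.
rewrite (_ : occupies _ _ _ _ = occupies T (trace y jl) k t).
  by rewrite subrr normr0; apply: sumr_ge0.
have szl : size jl.2 = N by rewrite size_tuple.
apply: occupies_eq; rewrite /= ?size_plan_times ?szl //.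
move=> [|i] //= iN.
have := same (Ordinal (iN : (i < N)%N)) => /negbFE/eqP.
by rewrite -!nth_plan_times.
Qed.

Lemma mass_dist x y k t : unit_cube x -> unit_cube y ->
  `|mass x k t - mass y k t| <=
  step_bound (\sum_jl `|share x jl - share y jl|)
    (fun b => T * x (inr b)) (fun b => T * y (inr b)) t.
Proof.
move=> xc yc; rewrite /mass -sumrB; apply: le_trans (ler_norm_sum _ _ _) _.
rewrite /step_bound.
rewrite (eq_bigr (fun b => (fun jl i =>
  (Num.min (T * x (inr (jl, i))) (T * y (inr (jl, i))) <= t <=
   Num.max (T * x (inr (jl, i))) (T * y (inr (jl, i))))%R%:R) b.1 b.2)); last by case.
rewrite -(pair_bigA _ (fun jl i =>
  (Num.min (T * x (inr (jl, i))) (T * y (inr (jl, i))) <= t <=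
   Num.max (T * x (inr (jl, i))) (T * y (inr (jl, i))))%R%:R)) /=.
rewrite -big_split /=.
pose h j l := `|share x (j, l) - share y (j, l)| +
  \sum_(i < N) (Num.min (T * x (inr (j, l, i))) (T * y (inr (j, l, i))) <= t <=
   Num.max (T * x (inr (j, l, i))) (T * y (inr (j, l, i))))%R%:R.
rewrite [leRHS](eq_bigr (fun jl => h jl.1 jl.2)); last by case.
rewrite -(pair_bigA _ h) /=; apply: ler_sum => j _.
rewrite -mulrBr -sumrB normrM ger0_norm //.
apply: (@le_trans _ _ `|\sum_(l : plan)
   (share x (j, l) * (occupies T (trace x (j, l)) k t)%:R -
    share y (j, l) * (occupies T (trace y (j, l)) k t)%:R)|).
  by rewrite ler_piMl // rho0_le1.
apply: le_trans (ler_norm_sum _ _ _) _; apply: ler_sum => l _.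
have := occupies_dist x y (j, l) k t; rewrite /h.
set e := (occupies _ _ _ _)%:R; set e' := (occupies _ _ _ _)%:R => ee'.
(* Separates the change of weights from the change of switching times. *)
have -> : share x (j, l) * e - share y (j, l) * e' =
  (share x (j, l) - share y (j, l)) * e + share y (j, l) * (e - e') by ring.
apply: le_trans (ler_normD _ _) _.
rewrite (normrM _ e) (normrM _ (e - e')) lerD //.
  by rewrite ler_piMr // ger0_norm // lern1 leq_b1.
apply: le_trans ee'; rewrite ler_piMl // ger0_norm ?share_ge0 //.
exact: share_le1.
Qed.

Lemma masses_ex : exists g : (unknown -> R) -> masses N T,
  forall x, unit_cube x -> forall k, {ae leb0T T, forall t, g x k t = mass x k t}.
Proof.
have ex x : exists rho : masses N T, unit_cube x ->
    forall k, {ae leb0T T, forall t, rho k t = mass x k t}.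
  have [xc|nxc] := pselect (unit_cube x); last first.
    by have [g _] := @Lspace_ex R T (ltW hT) (cst 0)
      (@measurable_cst _ _ _ _ _ _) (fun=> introT andP (conj (lexx _) ler01));
      exists (fun=> g).
  have H k : exists g : LspaceType2 (leb0T T),
      {ae leb0T T, forall t, g t = mass x k t}.
    apply: (Lspace_ex (ltW hT) (mass_measurable x k)) => t.
    exact: mass01.
  by have [rho rhoP] := choice H; exists rho.
by have [g gP] := choice ex; exists g.
Qed.

Lemma calL_mass x (rho : masses N T) : unit_cube x ->
  (forall k, {ae leb0T T, forall t, rho k t = mass x k t}) -> calL rho.
Proof.
by move=> xc H k; apply: filterS (H k) => t ->; exact: mass01.
Qed.

Lemma share_cvg x jl : share y jl @[y --> cube_nbhs x] --> share x jl.
Proof.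
have FF := cube_nbhs_filter x; case: jl => j l.
apply: cvgM; first exact: cube_nbhs_proj.
apply: cvgV; first by rewrite gt_eqF // max1_gt0.
apply: max_cvg; first exact: cvg_cst.
by apply: sum_cvg => l'; exact: cube_nbhs_proj.
Qed.

Lemma L2dist_mass_cvg (g : (unknown -> R) -> masses N T) x : unit_cube x ->
  (forall x, unit_cube x -> forall k,
    {ae leb0T T, forall t, g x k t = mass x k t}) ->
  L2dist (g y) (g x) @[y --> cube_nbhs x] --> (0 : R).
Proof.
move=> xc gP; have FF := cube_nbhs_filter x.
pose bound y := #|{: node N}|%:R * ((\sum_jl `|share y jl - share x jl|) * T +
  \sum_(b : node N * plan * 'I_N) `|T * y (inr b) - T * x (inr b)|).
have b0 : bound y @[y --> cube_nbhs x] --> (0 : R).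
  rewrite -[X in _ --> X](mulr0 #|{: node N}|%:R); apply: cvgM; first exact: cvg_cst.
  rewrite -[X in _ --> X]addr0; apply: cvgD.
    rewrite -[X in _ --> X](mul0r T); apply: cvgM; last exact: cvg_cst.
    apply: sum_cvg0 => jl; rewrite -[X in _ --> X](normr0 R) -(subrr (share x jl)).
    by apply: cvg_norm; apply: cvgB; [exact: share_cvg|exact: cvg_cst].
  apply: sum_cvg0 => b; rewrite -[X in _ --> X](normr0 R) -(subrr (T * x (inr b))).
  apply: cvg_norm; apply: cvgB; last exact: cvg_cst.
  by apply: cvgM; [exact: cvg_cst|exact: cube_nbhs_proj].
apply: (@squeeze_cvgr _ _ _ _ (fun=> 0) (Num.sqrt \o bound)).
- apply: filterS (cube_nbhs_cube x) => y yc; rewrite sqrtr_ge0 /=.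
  apply: (L2dist_le (ltW hT) (gP y yc) (gP x xc)) => [k t|k t||k t].
  + exact: mass01.
  + exact: mass01.
  + exact: sumr_ge0.
  + exact: mass_dist.
- exact: cvg_cst.
- rewrite -[X in _ --> X](sqrtr0 R); apply: cvg_comp b0 _; exact: sqrt_continuous.
Qed.

End Parametrization.

(** * Existence of an equilibrium *)

Section Complementarity.
Variables (R : realType) (B : finType).

Definition clamp (a : R) : R := Num.max 0 (Num.min 1 a).

Lemma clamp01 a : 0 <= clamp a <= 1.
Proof. by rewrite /clamp le_max lexx /= ge_max ler01 ge_min lexx. Qed.

(** If the sum were below 1, a coordinate with [e b = 0] would strictly increase. So the added term
    is 0, and a positive [e b] would strictly lower a positive [u b]. *)
Lemma clamp_complementarity (u e : B -> R) :
  (forall b, 0 <= u b) -> (forall b, 0 <= e b) -> (exists b, e b = 0) ->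
  (forall b, clamp (u b - e b + Num.max 0 (1 - \sum_a u a)) = u b) ->
  1 <= \sum_a u a /\ forall b, u b != 0 -> e b = 0.
Proof.
move=> u0 e0 [b0 eb0] fix_u.
have sum1 : 1 <= \sum_a u a.
  rewrite leNgt; apply/negP => lt1.
  have ub : u b0 <= \sum_a u a by rewrite (bigD1 b0) //= lerDl sumr_ge0.
  have m1 : 0 <= 1 - \sum_a u a by rewrite subr_ge0 ltW.
  have := fix_u b0; rewrite eb0 subr0 /clamp (max_idPr m1).
  by case: (leP 1 (u b0 + _)) => a1; case: (leP 0 _) => a0; have := u0 b0; lra.
have m0 : 1 - \sum_a u a <= 0 by rewrite subr_le0.
split=> // b ub0; have := fix_u b; rewrite (max_idPl m0) addr0 /clamp.
have ub : 0 < u b by rewrite lt_neqAle eq_sym ub0 u0.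
by case: (leP 1 (u b - e b)) => a1; case: (leP 0 _) => a0; have := e0 b; lra.
Qed.

End Complementarity.

(** Several node sequences may yield the same path, whose weight is then the sum of theirs. *)
Lemma fsbig_routes (R : realType) (L : finType) (K : choiceType) (A : set K)
    (r : L -> K) (w : L -> R) (G : K -> R) :
  (forall l, w l != 0 -> A (r l)) ->
  \sum_(z \in A) ((\sum_l (r l == z)%:R * w l) * G z) = \sum_l w l * G (r l).
Proof.
move=> wA; pose rs := undup [seq r l | l <- enum L & w l != 0].
have rsA z : z \in rs -> A z.
  by rewrite mem_undup => /mapP[l]; rewrite mem_filter => /andP[/wA ? _] ->.
have rsP l : w l != 0 -> r l \in rs.
  by move=> wl; rewrite mem_undup map_f // mem_filter wl mem_enum.
rewrite (fsbigE rs) ?undup_uniq //; last first.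
  move=> z _ zrs; rewrite big1 ?mul0r // => l _.
  have [->|/rsP rl] := eqVneq (w l) 0; first by rewrite mulr0.
  case: eqP => [rz|_]; last by rewrite mul0r.
  by rewrite -rz rl in zrs.
rewrite big_seq_cond (eq_bigl (fun z => z \in rs)); last first.
  by move=> z; case zrs: (z \in rs) => //=; apply/mem_set/rsA.
rewrite -big_seq; under eq_bigr do rewrite mulr_suml.
rewrite exchange_big /=; apply: eq_bigr => l _.
have [->|/rsP rl] := eqVneq (w l) 0.
  by rewrite mul0r big1 // => z _; rewrite mulr0 mul0r.
rewrite (bigD1_seq (r l)) ?undup_uniq //= eqxx mul1r big1 ?addr0 // => z zl.
by rewrite eq_sym (negbTE zl) !mul0r.
Qed.

Theorem theorem6p1 (R : realType) (N : nat) (T : R)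
    (C : node N -> node N -> R -> R -> masses N T -> R)
    (Ctil : node N -> R -> R) (rho0 : node N -> R)
    (hN : (1 <= N)%N) (hT : 0 < T)
    (hC0 : cost_ge0 C)
    (hCtil : final_cost_regular T Ctil)
    (hClip : cost_bounded_lipschitz C)
    (hCdec : cost_decreasing C)
    (hCblow : cost_blowup C)
    (hCcont : cost_continuous C)
    (hCconv : cost_convention C)
    (hmono : switch_monotone C Ctil)
    (hsingle : switch_single_valued C Ctil)
    (hrho0 : forall j, 0 <= rho0 j)
    (hrho0sum : \sum_(j : node N) rho0 j <= 1) :
  exists2 rho : masses N T, calL rho & psi C Ctil rho0 rho rho.
Proof.
have [g gP] := masses_ex hT hrho0 hrho0sum.
have gL x : unit_cube x -> calL (g x).
  by move=> xc; exact: (calL_mass hrho0 hrho0sum xc (gP x xc)).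
have zeroT : 0 <= (0 : R) <= T by rewrite lexx ltW.
(* The guess [x] generates the masses [g x]; weights are corrected by the excesses and times
   replaced by the optimal times for these masses. *)
pose Fmap (x : unknown N -> R) (u : unknown N) : R := match u with
  | inl jl => clamp (x (inl jl) - excess C Ctil (g x) jl.1 0 jl.2
                     + Num.max 0 (1 - raw_total x jl.1))
  | inr (jl, i) => nth T (times C Ctil (g x) jl.1 0 jl.2) i / T
  end.
have Fcube x : unit_cube x -> unit_cube (Fmap x).
  move=> xc [jl|[jl i]] /=; first exact: clamp01.
  have /andP[a b] := times_le hT hsingle jl.1 jl.2 i (gL x xc) zeroT.
  by rewrite divr_ge0 ?(ltW hT) //= ler_pdivrMr // mul1r.
have Fcont x i : unit_cube x -> Fmap y i @[y --> cube_nbhs x] --> Fmap x i.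
  move=> xc; have FF := cube_nbhs_filter x.
  have rL : \forall y \near cube_nbhs x, calL (g y).
    by apply: filterS (cube_nbhs_cube x) => y; exact: gL.
  have rr := L2dist_mass_cvg hT hrho0 hrho0sum xc gP.
  have lk (j : node N) : locked T (cube_nbhs x) j (fun=> 0) 0.
    split=> //; [exact: cvg_cst|exact: nearW|].
    by move=> _ E; move: hT; rewrite -E ltxx.
  case: i => [jl|[jl i]] /=.
    apply: max_cvg; first exact: cvg_cst.
    apply: min_cvg; first exact: cvg_cst.
    apply: cvgD.
      apply: cvgB; first exact: cube_nbhs_proj.
      exact: (excess_cvg hT hC0 hCtil hClip hCdec hCblow hCcont hsingle FF
        (gL x xc) rL rr (l := jl.2) (lk jl.1)).
    apply: max_cvg; first exact: cvg_cst.
    apply: cvgB; first exact: cvg_cst.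
    by apply: sum_cvg => l; exact: cube_nbhs_proj.
  apply: cvgM; last exact: cvg_cst.
  exact: (times_cvg hT hC0 hCtil hClip hCdec hCblow hCcont hsingle FF
    (gL x xc) rL rr (l := jl.2) (i := i) (lk jl.1)).
have [x xc xfix] := brouwer Fcube Fcont.
have rhoL := gL x xc; exists (g x) => //.
have weights j : 1 <= raw_total x j /\
    forall l : N.-tuple (node N), x (inl (j, l)) != 0 ->
      excess C Ctil (g x) j 0 l = 0.
  apply: (clamp_complementarity (u := fun l => x (inl (j, l)))).
  - by move=> l; case/andP: (xc (inl (j, l))).
  - by move=> l; exact: excess_ge0.
  - have [|l lN l0] := excess0_ex hT hsingle (n := N) rhoL zeroT (p := j).
      exact: leq_subr.
    by exists (Tuple (introT eqP lN)).
  - by move=> l; exact: (xfix (inl (j, l))).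
(* At the fixed point the guessed times are the optimal ones for the masses they generate. *)
have traceE jl : trace T x jl =
    zip (jl.1 :: jl.2) (0 :: times C Ctil (g x) jl.1 0 jl.2).
  congr (zip _ (_ :: _)); apply: (@eq_from_nth _ T).
    by rewrite size_plan_times size_times size_tuple.
  move=> i; rewrite size_plan_times => iN.
  rewrite (nth_plan_times T x jl (Ordinal iN)) -(xfix (inr (jl, Ordinal iN))) /=.
  by rewrite mulrC divfK // gt_eqF.
have share_sum j : \sum_(l : N.-tuple (node N)) share x (j, l) = 1.
  rewrite /share /= -mulr_suml; have [ge1 _] := weights j.
  by rewrite (max_idPr ge1) divff // gt_eqF // (lt_le_trans ltr01).
pose r j (l : N.-tuple (node N)) := route C Ctil (g x) j 0 l.
have rA j l : share x (j, l) != 0 -> opt_paths C Ctil (g x) j (r j l).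
  rewrite mulf_eq0 negb_or => /andP[/(proj2 (weights j)) e0 _].
  have [|opt stop] := route_optimal hT hsingle rhoL zeroT _ e0.
    by rewrite size_tuple leq_subr.
  rewrite /opt_paths /= /r; split.
  - by case: (l : seq _).
  - by case: (l : seq _).
  - by move=> i; exact: opt.
  - by rewrite nth_last; exact: stop.
(* A path determines its initial node, so one weight function serves all [j]; optimal paths are
   nonempty, so the default of [head] never matters for them. *)
pose w (pth : seq (node N * R)) := let j := (head (pbar N, 0) pth).1 in
  \sum_l (r j l == pth)%:R * share x (j, l).
have wE j G : \sum_(pth \in opt_paths C Ctil (g x) j) w pth * G pth =
    \sum_l share x (j, l) * G (r j l).
  rewrite -(fsbig_routes G (rA j)); apply: eq_fsbigr => pth.
  rewrite inE => -[sz hd _ _]; congr (_ * _); rewrite /w.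
  by move: sz hd; case: pth => //= a pth _ ->.
exists w; split.
- by move=> j pth _; apply: sumr_ge0 => l _; rewrite mulr_ge0 // share_ge0.
- move=> j; rewrite -[RHS](share_sum j).
  rewrite (eq_bigr (fun l => share x (j, l) * 1)) => [|l _]; last by rewrite mulr1.
  by rewrite -(wE j (fun=> 1)); apply: eq_fsbigr => pth _; rewrite mulr1.
- move=> k; apply: filterS (gP x xc k) => t ->; apply: eq_bigr => j _.
  congr (_ * _); rewrite (wE j (fun pth => evol T pth k t)).
  by apply: eq_bigr => l _; rewrite evolE /r occupies_route traceE.
Qed.
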